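(* Let $d\ge 1$, $I=\{1,\dots,d\}$, let $D=\prod_{i=1}^d D_i$ with each $D_i\subseteq\mathbb{R}$ Borel measurable and endowed with a probability measure $\nu_i$, and let $\nu=\bigotimes_{i=1}^d\nu_i$. Let $k:D\times D\to\mathbb{R}$ be $\nu\otimes\nu$-square integrable. (a) There exist $k_{u,v}\in L^2(\nu\otimes\nu)$ ($u,v\subseteq I$), with $k_{u,v}$ depending solely on $(\mathbf{x}_u,\mathbf{y}_v)$, such that $k$ can be decomposed in a unique way as $k=\sum_{u,v\subseteq I}k_{u,v}$ under the conditions that for all $u,v\subseteq I$: $$\int k_{u,v}\,\nu_i(\mathrm{d}x_i)=\mathbf{0}\ \text{ for every } i\in u,\qquad \int k_{u,v}\,\nu_j(\mathrm{d}y_j)=\mathbf{0}\ \text{ for every } j\in v.$$ We have $$k_{u,v}(\mathbf{x},\mathbf{y})=\sum_{u'\subseteq u}\sum_{v'\subseteq v}(-1)^{|u|+|v|-|u'|-|v'|}\int k(\mathbf{x},\mathbf{y})\,\nu_{-u'}(\mathrm{d}\mathbf{x}_{-u'})\,\nu_{-v'}(\mathrm{d}\mathbf{y}_{-v'}).$$ Moreover, $k_{u,v}=[T_u\otimes T_v]k$. (b) Suppose in addition that $D$ is compact and $k$ is a continuous symmetric positive definite kernel. Then for any $(\alpha_u)_{u\subseteq I}\in\mathbb{R}^{2^d}$ the function $$(\mathbf{x},\mathbf{y})\in D\times D\longmapsto\sum_{u\subseteq I}\sum_{v\subseteq I}\alpha_u\alpha_v\,k_{u,v}(\mathbf{x},\mathbf{y})\in\mathbb{R}$$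 is also a symmetric positive definite kernel.
   Context: For $u\subseteq I$, $\mathbf{x}_u=(x_i)_{i\in u}$, $\mathbf{x}_{-u}=(x_i)_{i\in I\setminus u}$ and $\nu_{-u}=\bigotimes_{j\in I\setminus u}\nu_j$; integration against $\nu_{-u'}(\mathrm{d}\mathbf{x}_{-u'})$ integrates out the coordinates $x_j$, $j\notin u'$, leaving the others fixed (and similarly for $\mathbf{y}$). Statements about elements of $L^2$ (equality, dependence on given variables only, uniqueness) are understood up to almost-everywhere equality. In part (b), where $k$ is continuous on the compact set $D\times D$, $k_{u,v}$ denotes the function defined at every point by the explicit formula in part (a). Let $\mathcal{F}=L^2(\nu)$. For $j\in I$, $P_j:\mathcal{F}\to\mathcal{F}$, $P_jf=\int f\,\mathrm{d}\nu_j$ (integration over the variable $x_j$), is the orthogonal projector onto the subspace of functions not depending on $x_j$. For $u\subseteq I$, $T_u=\bigl(\prod_{j\in u}(I_{\mathcal{F}}-P_j)\bigr)\bigl(\prod_{j\in I\setminus u}P_j\bigr)$, where $I_{\mathcal F}$ is the identity. Identifying $L^2(\nu\otimes\nu)$ with $\mathcal{F}\otimes\mathcal{F}$, $T_u\otimes T_v=T_u^{(1)}T_v^{(2)}=T_v^{(2)}T_u^{(1)}$, where $(T_u^{(1)}k)(\mathbf{x},\mathbf{y})=(T_u(k(\bullet,\mathbf{y})))(\mathbf{x})$ and $(T_v^{(2)}k)(\mathbf{x},\mathbf{y})=(T_v(k(\mathbf{x},\bullet)))(\mathbf{y})$. A symmetric positive definite (s.p.d.) kernel on $D$ is a symmetric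 function $k:D\times D\to\mathbb{R}$ with $\sum_{i,j=1}^n a_ia_jk(\mathbf{x}^{(i)},\mathbf{x}^{(j)})\ge 0$ for all $n\ge1$, $\mathbf{x}^{(1)},\dots,\mathbf{x}^{(n)}\in D$, $a_1,\dots,a_n\in\mathbb{R}$ (strict positivity is not required). *)

(* Defs.v *)
From HB Require Import structures.
From mathcomp Require Import all_boot all_order all_algebra.
From mathcomp Require Import all_classical all_reals all_analysis.

Set Implicit Arguments.
Unset Strict Implicit.
Unset Printing Implicit Defensive.

Import Order.TTheory GRing.Theory Num.Theory.
Import numFieldNormedType.Exports.

Local Open Scope classical_set_scope.
Local Open Scope ring_scope.

(** ** Real vectors indexed by a finite set, and product probabilities *)

(** [vec J R] is R^J with the product topology and the product (Borel)
    sigma-algebra, i.e. the one generated by the coordinate maps. *)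
Definition vec (J : finType) (R : realType) : Type := J -> R.

HB.instance Definition _ (J : finType) (R : realType) :=
  Topological.copy (vec J R) {ptws J -> R}.

HB.instance Definition _ (J : finType) (R : realType) :=
  isPointed.Build (vec J R) (fun=> 0).

Definition vec_display : measure_display. Proof. exact. Qed.

Section vec_measurable.
Context (J : finType) (R : realType).

Definition vec_cylinders : set (set (vec J R)) :=
  [set A | exists j : J, exists2 B : set R,
     measurable B & A = [set x : vec J R | B (x j)]].

Let vec_setC A : <<s vec_cylinders >> A -> <<s vec_cylinders >> (~` A).
Proof. exact: sigma_algebraC. Qed.

Let vec_bigcup (F : (set (vec J R))^nat) :
  (forall i, <<s vec_cylinders >> (F i)) -> <<s vec_cylinders >> (\bigcup_i F i).
Proof. exact: sigma_algebra_bigcup. Qed.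

HB.instance Definition _ := @isMeasurable.Build vec_display (vec J R)
  <<s vec_cylinders >> (@sigma_algebra0 _ _ _) vec_setC vec_bigcup.

End vec_measurable.

Lemma measurable_vec_coord (J : finType) (R : realType) (j : J) :
  measurable_fun [set: vec J R] (fun x : vec J R => x j).
Proof.
move=> _ B mB; rewrite setTI; apply: sub_sigma_algebra.
by exists j, B.
Qed.

Lemma measurable_to_vec d (T : measurableType d) (J : finType) (R : realType)
    (f : T -> vec J R) :
  (forall j, measurable_fun [set: T] (fun t => f t j)) ->
  measurable_fun [set: T] f.
Proof.
move=> mf; apply: (measurability (@vec_cylinders J R)) => //.
by move=> _ [_ [j [B mB ->]] <-]; exact: mf.
Qed.

Definition vec_cons n (R : realType) (p : R * vec 'I_n R) : vec 'I_n.+1 R :=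
  fun i => if unlift ord0 i is Some j then p.2 j else p.1.

Lemma measurable_vec_cons n (R : realType) :
  measurable_fun [set: R * vec 'I_n R] (@vec_cons n R).
Proof.
apply: measurable_to_vec => i; rewrite /vec_cons.
case: (unlift ord0 i) => [j|]; last exact: measurable_fst.
by apply: measurableT_comp (measurable_vec_coord j) _; exact: measurable_snd.
Qed.

HB.instance Definition _ n (R : realType) :=
  isMeasurableFun.Build _ _ _ _ (@vec_cons n R) (@measurable_vec_cons n R).

(** [nu 0 \x (nu 1 \x ( ... \x nu (n - 1)))], transported to ['I_n -> R]. *)
Fixpoint ord_prod_prob (R : realType) n :
    ('I_n -> probability R R) -> probability (vec 'I_n R) R :=
  match n with
  | 0 => fun=> \d_(point : vec 'I_0 R)
  | m.+1 => fun nu =>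
      distribution (nu ord0 \x ord_prod_prob (fun i => nu (lift ord0 i)))%E
        (@vec_cons m R)
  end.

Definition vec_reindex (R : realType) (J : finType) (x : vec 'I_#|J| R) :
  vec J R := fun j => x (enum_rank j).

Lemma measurable_vec_reindex (R : realType) (J : finType) :
  measurable_fun [set: vec 'I_#|J| R] (@vec_reindex R J).
Proof. by apply: measurable_to_vec => j; exact: measurable_vec_coord. Qed.

HB.instance Definition _ (R : realType) (J : finType) :=
  isMeasurableFun.Build _ _ _ _ (@vec_reindex R J) (@measurable_vec_reindex R J).

Definition prod_prob (R : realType) (J : finType) (nu : J -> probability R R) :
    probability (vec J R) R :=
  distribution (ord_prod_prob (fun i => nu (enum_val i))) (@vec_reindex R J).

Definition box (R : realType) (J : finType) (D : J -> set R) : set (vec J R) :=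
  [set x | forall j, D j (x j)].

Lemma measurable_box (R : realType) (J : finType) (D : J -> set R) :
  (forall j, measurable (D j)) -> measurable (box D).
Proof.
move=> mD; have -> : box D = \bigcap_(j in [set: J]) [set x : vec J R | D j (x j)].
  by apply/seteqP; split=> x /= Dx j; [move=> _; exact: Dx|exact: Dx].
apply: fin_bigcap_measurable; first exact: finite_finset.
by move=> j _; rewrite -[X in measurable X]setTI; exact: measurable_vec_coord.
Qed.

Lemma ord_prod_prob_box (R : realType) n (nu : 'I_n -> probability R R)
    (D : 'I_n -> set R) :
  (forall i, measurable (D i)) ->
  ord_prod_prob nu (box D) = (\prod_(i < n) nu i (D i))%E.
Proof.
elim: n nu D => [|n IHn] nu D mD.
  rewrite big_ord0 /= diracE mem_set// => -[]//.
rewrite big_ord_recl /= /distribution /pushforward.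
have -> : @vec_cons n R @^-1` box D =
    D ord0 `*` box (fun i => D (lift ord0 i)).
  apply/seteqP; split=> -[a x] /= => [Dx|[Da Dx] i]; rewrite /vec_cons.
    split=> [|j]; first by have := Dx ord0; rewrite /vec_cons unlift_none.
    by have := Dx (lift ord0 j); rewrite /vec_cons liftK.
  by case: unliftP => [j ->|->].
rewrite product_measure1E//; last exact: measurable_box.
by congr (_ * _)%E; exact: IHn.
Qed.

(** The defining property of [\bigotimes_j nu_j]. *)
Lemma prod_prob_box (R : realType) (J : finType) (nu : J -> probability R R)
    (D : J -> set R) :
  (forall j, measurable (D j)) ->
  prod_prob nu (box D) = (\prod_(j : J) nu j (D j))%E.
Proof.
move=> mD; rewrite /prod_prob /= /distribution /pushforward.
have -> : @vec_reindex R J @^-1` box D = box (fun i => D (enum_val i)).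
  apply/seteqP; split=> x Dx => [i|j].
    by have := Dx (enum_val i); rewrite /vec_reindex enum_valK.
  by rewrite /vec_reindex; have := Dx (enum_rank j); rewrite enum_rankK.
rewrite ord_prod_prob_box//.
rewrite [RHS](reindex (@enum_val J predT))//=.
by apply: onW_bij; exact: enum_val_bij.
Qed.

(** ** Square-integrable kernels on [D x D], [D = box D] *)

Section kernels.
Context (R : realType) (d : nat).
Variables (D : 'I_d -> set R) (nu : 'I_d -> probability R R).

Local Notation X := (vec 'I_d R).
Implicit Types (u v : {set 'I_d}) (x y : X) (f : X -> R) (k : X -> X -> R).

Definition nunu : probability (X * X)%type R :=
  (prod_prob nu \x prod_prob nu)%E.

(** A kernel on [D x D] is represented by a total function of which only the
    values on [D x D] matter: it is extended by 0 before testing membership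
    in L^2, and a.e. equality is only required on [D x D]. *)
Definition uncurry_kernel k : X * X -> R := fun p => k p.1 p.2.

Definition L2_kernel k : Prop :=
  uncurry_kernel k \_ (box D `*` box D) \in Lfun nunu 2%:E.

Definition ae_eq_kernel k1 k2 : Prop :=
  ae_eq nunu (box D `*` box D) (uncurry_kernel k1) (uncurry_kernel k2).

(** The L^2-class of [k] contains a function of [(x_u, y_v)] alone. *)
Definition depends_only_on u v k : Prop :=
  exists g : X -> X -> R,
    [/\ L2_kernel g,
        (forall x y x' y', box D x -> box D y -> box D x' -> box D y' ->
           (forall i, i \in u -> x i = x' i) ->
           (forall j, j \in v -> y j = y' j) -> g x y = g x' y') &
        ae_eq_kernel k g].

Definition update x (j : 'I_d) (t : R) : X := fun i => if i == j then t else x i.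

(** [P_j f = \int f d nu_j], integration over the variable [x_j]. *)
Definition proj (j : 'I_d) f : X -> R :=
  fun x => \int[nu j]_(t in D j) f (update x j t).

(** [T_u = \prod_(j in u) (I - P_j) \prod_(j notin u) P_j].
    The products are compositions of operators, taken in the order of the
    indices; the operators commute on L^2(nu). *)
Definition Tproj u : (X -> R) -> (X -> R) :=
  (\big[comp/idfun]_(j in u) (fun f x => f x - proj j f x)) \o
  (\big[comp/idfun]_(j in ~: u) proj j).

(** [T_u] acting on the first, resp. second, argument; [T_u \otimes T_v] is
    [Tproj1 u \o Tproj2 v = Tproj2 v \o Tproj1 u] on L^2. *)
Definition Tproj1 u k : X -> X -> R := fun x y => Tproj u (fun x' => k x' y) x.
Definition Tproj2 v k : X -> X -> R := fun x y => Tproj v (fun y' => k x y') y.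

Definition kanova_decomposition k (K : {set 'I_d} -> {set 'I_d} -> X -> X -> R) :
    Prop :=
  [/\ (forall u v, L2_kernel (K u v)),
      (forall u v, depends_only_on u v (K u v)),
      ae_eq_kernel k (fun x y => \sum_(u : {set 'I_d}) \sum_(v : {set 'I_d}) K u v x y),
      (forall u v i, i \in u ->
         ae_eq_kernel (fun x y => proj i (fun x' => K u v x' y) x) (fun _ _ => 0)) &
      (forall u v j, j \in v ->
         ae_eq_kernel (fun x y => proj j (fun y' => K u v x y') y) (fun _ _ => 0))].

(** Coordinates indexed by [~: u], [nu_{-u}], and the vector with coordinates
    [x_j] for [j \in u] and [z_j] for [j \notin u]. *)
Definition co u : finType := {j : 'I_d | j \notin u}.

Definition nu_co u : probability (vec (co u) R) R :=
  prod_prob (fun j : co u => nu (val j)).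

Definition box_co u : set (vec (co u) R) := box (fun j : co u => D (val j)).

Definition glue u x (z : vec (co u) R) : X :=
  fun i => if insub i is Some j then z j else x i.

(** [\int k(x, y) nu_{-u}(dx_{-u}) nu_{-v}(dy_{-v})]: the coordinates outside
    [u], resp. [v], are integrated out. *)
Definition integrate_out u v k : X -> X -> R := fun x y =>
  \int[(nu_co u \x nu_co v)%E]_(p in @box_co u `*` @box_co v)
    k (glue x p.1) (glue y p.2).

Definition kanova_term k u v : X -> X -> R := fun x y =>
  \sum_(u' : {set 'I_d} | u' \subset u) \sum_(v' : {set 'I_d} | v' \subset v)
    (-1) ^+ (#|u| + #|v| - #|u'| - #|v'|) * integrate_out u' v' k x y.

End kernels.

Definition spd_kernel (T : Type) (R : realType) (A : set T) (k : T -> T -> R) :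
    Prop :=
  (forall x y, A x -> A y -> k x y = k y x) /\
  (forall n (x : 'I_n -> T) (a : 'I_n -> R), (1 <= n)%N ->
     (forall i, A (x i)) ->
     0 <= \sum_(i < n) \sum_(j < n) a i * a j * k (x i) (x j)).

(* Main.v *)
(** Let [E_(u,v)] integrate out the coordinates [x_j], [j \notin u], and [y_j],
    [j \notin v]. The law of the resampled point is a product of Dirac masses and
    of the [nu_j], so by uniqueness of product measures and Fubini the operators
    [E_w] are almost everywhere well defined on [L^2] and satisfy
    [E_w E_w' = E_(w \cap w')]; the projector [P_j] acting on [x] is
    [E_(I \ j, I)]. If [k = \sum_w k_w] satisfies the conditions of (a), then
    [E_w' k_w] is [k_w] when [w] is contained in [w'] and [0] otherwise, so that
    [k_w] is recovered from the [E_w' k] by Moebius inversion, and [T_u], [T_v]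
    act on [\sum_w c_w k_w] by multiplying coefficients.

    For (b), the new kernel is
    [\sum_(a, b) beta_a beta_b \int\int k dQ_(a,x) dQ_(b,y)] with probability
    measures [Q_(a,x)], so it suffices that
    [\sum_(p, q) c_p c_q \int\int k dm_p dm_q >= 0] for all probability measures
    [m_p]. Apply positivity of [k] to [N] independent samples of each [m_p], take
    expectations, divide by [N ^ 2], and let [N] go to infinity. *)

Require Import Defs.
From HB Require Import structures.
From mathcomp Require Import all_boot all_order all_algebra.
From mathcomp Require Import all_classical all_reals all_analysis.
From mathcomp Require Import measurable_realfun zify ring lra.

Import Order.TTheory GRing.Theory Num.Theory.
Import numFieldNormedType.Exports.

Local Open Scope classical_set_scope.
Local Open Scope ring_scope.

(** * Averages over resampled coordinates *)

Section law.
Local Open Scope ereal_scope.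
Context {d1 d2 d3} {X1 : measurableType d1} {X2 : measurableType d2}
  {Y : measurableType d3} {R : realType}.
Variables (m1 : {measure set X1 -> \bar R}) (m2 : {measure set X2 -> \bar R}).
Variables (f1 : X1 -> Y) (f2 : X2 -> Y).
Hypotheses (mf1 : measurable_fun setT f1) (mf2 : measurable_fun setT f2).
Hypothesis law12 : forall A, measurable A -> m1 (f1 @^-1` A) = m2 (f2 @^-1` A).

(** Both sides integrate [h] against one push-forward measure. This is how one source of randomness
    is exchanged for another throughout. *)
Lemma law_ge0_integral (h : Y -> \bar R) : measurable_fun setT h ->
  (forall y, 0 <= h y) -> \int[m1]_x h (f1 x) = \int[m2]_x h (f2 x).
Proof.
move=> mh h0.
pose F1 : {mfun X1 >-> Y} := HB.pack f1 (isMeasurableFun.Build _ _ _ _ _ mf1).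
pose F2 : {mfun X2 >-> Y} := HB.pack f2 (isMeasurableFun.Build _ _ _ _ _ mf2).
have e1 := @ge0_integral_pushforward _ _ _ _ _ F1 mf1 m1 setT h measurableT mh
  (fun y _ => h0 y).
have e2 := @ge0_integral_pushforward _ _ _ _ _ F2 mf2 m2 setT h measurableT mh
  (fun y _ => h0 y).
rewrite /= preimage_setT in e1; rewrite /= preimage_setT in e2.
rewrite /comp in e1 e2; rewrite -e1 -e2.
by apply: eq_measure_integral => A mA _; exact: law12.
Qed.

Lemma law_integral (h : Y -> \bar R) : measurable_fun setT h ->
  \int[m1]_x h (f1 x) = \int[m2]_x h (f2 x).
Proof.
move=> mh; rewrite integralE [RHS]integralE; congr (_ - _).
- rewrite (_ : (fun x => h (f1 x))^\+ = (fun x => h^\+ (f1 x))); last first.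
    by apply/funext => x; rewrite !funeposE.
  rewrite (_ : (fun x => h (f2 x))^\+ = (fun x => h^\+ (f2 x))); last first.
    by apply/funext => x; rewrite !funeposE.
  by apply: law_ge0_integral => //; exact: measurable_funepos.
- rewrite (_ : (fun x => h (f1 x))^\- = (fun x => h^\- (f1 x))); last first.
    by apply/funext => x; rewrite !funenegE.
  rewrite (_ : (fun x => h (f2 x))^\- = (fun x => h^\- (f2 x))); last first.
    by apply/funext => x; rewrite !funenegE.
  by apply: law_ge0_integral => //; exact: measurable_funeneg.
Qed.

Lemma law_integrable (h : Y -> \bar R) : measurable_fun setT h ->
  m1.-integrable setT (h \o f1) -> m2.-integrable setT (h \o f2).
Proof.
move=> mh /integrableP[_ hoo]; apply/integrableP; split.
  exact: measurableT_comp.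
rewrite -(law_ge0_integral (fun y => `|h y|))//.
exact: measurableT_comp.
Qed.

End law.

Section jensen.
Context {d1} {T : measurableType d1} {R : realType}.
Variable P : probability T R.

(** Jensen's inequality for the square: with [c] the mean of [f], expand [0 <= \int (f - c) ^ 2]. An
    infinite right-hand side leaves nothing to prove. *)
Lemma sqr_Rintegral_le (f : T -> R) : measurable_fun setT f ->
  (((\int[P]_x f x) ^+ 2)%R%:E <= \int[P]_x (f x ^+ 2)%R%:E)%E.
Proof.
move=> mf.
have mf2 : measurable_fun setT (fun x => f x ^+ 2) by exact: measurable_funX.
have [oo|fin] := eqVneq (\int[P]_x (f x ^+ 2)%:E)%E +oo%E.
  by rewrite oo leey.
have if2 : P.-integrable setT (EFin \o (fun x => f x ^+ 2)).
  apply/integrableP; split; first exact/measurable_EFinP.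
  under eq_integral => x _ do rewrite /= ger0_norm ?sqr_ge0//.
  by rewrite ltey.
have i1 : P.-integrable setT (EFin \o cst 1).
  exact: finite_measure_integrable_cst.
have if1 : P.-integrable setT (EFin \o f).
  (* Finite second moment gives integrability through the domination [|f| <= 1 + f ^ 2]. *)
  apply: (le_integrable measurableT _ _ (integrableD measurableT i1 if2)).
    exact/measurable_EFinP.
  move=> x _ /=; rewrite lee_fin.
  rewrite [leRHS]ger0_norm ?addr_ge0 ?sqr_ge0//.
  rewrite -[f x ^+ 2]real_normK ?num_real//.
  have h0 : 0 <= `|f x| by [].
  by set a := `|f x| in h0 *; have := sqr_ge0 (a - 1); have := sqr_ge0 a; nra.
set c := \int[P]_x f x.
have Efin : (\int[P]_x (f x ^+ 2)%:E)%E = (\int[P]_x (f x ^+ 2))%:E.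
  by rewrite /Rintegral fineK//; exact: integrable_fin_num if2.
rewrite Efin lee_fin.
have h : 0 <= \int[P]_x ((f x ^+ 2 + (- (c *+ 2)) * f x) + c ^+ 2).
  apply: Rintegral_ge0 => x _.
  rewrite (_ : _ + _ = (f x - c) ^+ 2) ?sqr_ge0//.
  by ring.
have icf : P.-integrable setT (EFin \o (fun x => - (c *+ 2) * f x)).
  exact: (integrableZl measurableT (- (c *+ 2)) if1).
have icc : P.-integrable setT (EFin \o (fun=> c ^+ 2)).
  exact: finite_measure_integrable_cst.
move: h; rewrite RintegralD//; last exact: (integrableD measurableT if2 icf).
rewrite RintegralD// RintegralZl// -/c (_ : (\int[P]_x (c ^+ 2)) = c ^+ 2).
  rewrite mulNr mulrnAl -expr2; lra.
by rewrite Rintegral_cst// (_ : fine _ = 1) ?mulr1//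
  [X in fine X](@probability_setT _ _ _ P).
Qed.
End jensen.

Section linear_combination.
Context {d1} {T : measurableType d1} {R : realType}.
Variable mu : {measure set T -> \bar R}.
Variables (I : Type) (s : seq I) (c : I -> R) (f : I -> T -> R).
Hypothesis fi : forall i, mu.-integrable setT (EFin \o f i).

Lemma Rintegral_lincomb :
  \int[mu]_x (\sum_(i <- s) c i * f i x) = \sum_(i <- s) c i * \int[mu]_x f i x.
Proof.
rewrite /Rintegral; under eq_integral => x _ do rewrite -sumEFin.
rewrite integral_sum//; last first.
  by move=> i; exact: (integrableZl measurableT (c i) (fi i)).
rewrite -[RHS]/(fine (_%:E)) -sumEFin; congr fine; apply: eq_bigr => i _.
rewrite EFinM fineK; last exact: integrable_fin_num (fi i).
under eq_integral => x _ do rewrite EFinM.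
by rewrite (integralZl measurableT (fi i)).
Qed.
End linear_combination.

Lemma Lfun2P {d} {T : measurableType d} {R : realType}
    (mu : {measure set T -> \bar R}) (f : T -> R) :
  f \in Lfun mu 2%:E <->
  measurable_fun setT f /\ (\int[mu]_x ((f x) ^+ 2)%R%:E < +oo)%E.
Proof.
split=> [lf|[mf foo]].
  split; first by have := sub_Lfun_mfun lf; rewrite inE.
  have /integrableP[_] := Lfun2_integrable_sqr lf.
  by under eq_integral => x _ do rewrite /= ger0_norm ?sqr_ge0//.
rewrite inE; apply/andP; split; rewrite inE//=.
rewrite /finite_norm unlock /Lnorm poweR_lty//.
under eq_integral => x _ do rewrite /= powR_mulrn// real_normK ?num_real//.
exact: foo.
Qed.

Section averaging.
Context {d1 d2} {Om : measurableType d1} {Z : measurableType d2} {R : realType}.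

(* [G] resamples part of a point from the noise [z]; below, [G] preserves [mu]. *)
Definition avg (rho : probability Z R) (G : Om * Z -> Om) (f : Om -> R)
  (w : Om) : R := \int[rho]_z f (G (w, z)).

Variables (mu : probability Om R) (rho : probability Z R) (G : Om * Z -> Om).
Hypothesis mG : measurable_fun setT G.

(** Integrability is not assumed: Tonelli handles the positive and negative parts separately, and
    their extended-real difference is measurable. *)
Lemma measurable_integral_pair (h : Om * Z -> \bar R) : measurable_fun setT h ->
  measurable_fun setT (fun w => \int[rho]_z h (w, z))%E.
Proof.
move=> mh.
rewrite (_ : (fun _ => _) =
    (fun w => \int[rho]_z h^\+ (w, z) - \int[rho]_z h^\- (w, z))%E); last first.
  apply/funext => w; rewrite integralE; congr (_ - _)%E;
  by apply: eq_integral => z _; rewrite ?funeposE ?funenegE.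
apply: emeasurable_funB.
- by apply: measurable_fun_fubini_tonelli_F => //; exact: measurable_funepos.
- by apply: measurable_fun_fubini_tonelli_F => //; exact: measurable_funeneg.
Qed.

Lemma measurable_avg f : measurable_fun setT f ->
  measurable_fun setT (avg rho G f).
Proof.
move=> mf; apply: (measurableT_comp (f := fine)).
  by [].
apply: (measurable_integral_pair (fun p => (f (G p))%:E)).
by apply/measurable_EFinP; exact: measurableT_comp.
Qed.

Hypothesis hG : forall A, measurable A -> (mu \x rho)%E (G @^-1` A) = mu A.

(** Tonelli on the product of point and noise, followed by the invariance [hG] of [mu] under
    resampling. *)
Lemma avg_integral (h : Om -> \bar R) : measurable_fun setT h ->
  (forall w, 0 <= h w)%E ->
  (\int[mu]_w \int[rho]_z h (G (w, z)) = \int[mu]_w h w)%E.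
Proof.
move=> mh h0.
rewrite -(fubini_tonelli1 (fun p => h (G p)))//; last exact: measurableT_comp.
apply: (@law_ge0_integral _ _ _ _ _ _ _ (mu \x rho)%E mu G id mG _ _ h mh h0).
  exact: measurable_id.
by move=> A mA; rewrite preimage_id; exact: hG.
Qed.

(** Averaging contracts the L^2 norm: Jensen over the noise for each fixed point, then invariance of
    [mu]. *)
Lemma avg_Lfun2 f : f \in Lfun mu 2%:E -> avg rho G f \in Lfun mu 2%:E.
Proof.
move=> /Lfun2P[mf foo]; apply/Lfun2P; split; first exact: measurable_avg.
apply: le_lt_trans foo.
rewrite -(avg_integral (fun w => (f w ^+ 2)%:E)); last 2 first.
- by apply/measurable_EFinP; exact: measurable_funX.
- by move=> w; rewrite lee_fin sqr_ge0.
apply: ge0_le_integral => //.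
- by move=> w _; rewrite lee_fin sqr_ge0.
- by apply/measurable_EFinP; apply: measurable_funX; exact: measurable_avg.
- apply: (measurable_integral_pair (fun p => (f (G p) ^+ 2)%:E)).
  by apply/measurable_EFinP; apply: measurable_funX; exact: measurableT_comp.
- move=> w _; apply: (sqr_Rintegral_le rho (fun z => f (G (w, z)))).
  apply: measurableT_comp => //; apply: measurableT_comp => //.
Qed.

Lemma ae_integrable_avg f : mu.-integrable setT (EFin \o f) ->
  {ae mu, forall w, rho.-integrable setT (fun z => (f (G (w, z)))%:E)}.
Proof.
move=> fi; have mf := measurable_int _ fi.
have fGi : (mu \x rho)%E.-integrable setT ((EFin \o f) \o G).
  apply/integrableP; split; first exact: measurableT_comp.
  rewrite (fubini_tonelli1 (fun p => `|(EFin \o f) (G p)|)%E)//; last first.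
    by apply: measurableT_comp => //; exact: measurableT_comp.
  rewrite /fubini_F (avg_integral (fun w => `|(EFin \o f) w|)%E)//.
    by case/integrableP : fi.
  exact: measurableT_comp.
exact: (ae_integrable1 fGi).
Qed.

(** This makes averaging well defined on L^2 classes. By invariance the average of [|f - g|] over
    point and noise is zero, so for almost every [w] the functions [f] and [g] agree at almost every
    resampling of [w]. *)
Lemma ae_eq_avg f g : measurable_fun setT f -> measurable_fun setT g ->
  ae_eq mu setT f g -> ae_eq mu setT (avg rho G f) (avg rho G g).
Proof.
move=> mf mg fg.
pose h w := (`|f w - g w|)%:E : \bar R.
have mh : measurable_fun setT h.
  apply/measurable_EFinP; apply: measurableT_comp => //.
  exact: measurable_funB.
have h0 w : (0 <= h w)%E by rewrite lee_fin.
have mhG : measurable_fun setT (fun p => h (G p)) by exact: measurableT_comp.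
have I0 : (\int[mu]_w \int[rho]_z h (G (w, z)) = 0)%E.
  rewrite avg_integral//.
  rewrite (@ge0_ae_eq_integral _ _ _ mu setT h (cst 0%E))//.
    by rewrite integral0.
  by move: fg; apply: filterS => w /= /(_ I) fgw _; rewrite /h fgw subrr normr0.
have mI := measurable_integral_pair _ mhG.
have : ae_eq mu setT (fun w => \int[rho]_z h (G (w, z)))%E (cst 0%E).
  apply/ae_eq_integral_abs => //; rewrite -I0; apply: eq_integral => w _.
  by rewrite gee0_abs// integral_ge0.
apply: filterS => w /(_ I) /= hw _.
rewrite /avg /Rintegral; congr fine.
have sec (e : Om -> R) : measurable_fun setT e ->
    measurable_fun setT (fun z => (e (G (w, z)))%:E).
  move=> me; apply/measurable_EFinP; apply: measurableT_comp => //.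
  by apply: measurableT_comp => //.
apply: ae_eq_integral => //; [exact: sec|exact: sec|].
have : ae_eq rho setT (fun z => h (G (w, z))) (cst 0%E).
  apply/ae_eq_integral_abs => //.
    by apply: (sec (fun w => `|f w - g w|)); exact/measurable_EFinP.
  by rewrite -hw; apply: eq_integral => z _; rewrite gee0_abs.
apply: filterS => z /(_ I) /= + _; rewrite /h => -[/eqP].
by rewrite normr_eq0 subr_eq0 => /eqP ->.
Qed.

Lemma ae_forall_fin (I : finType) (P : I -> Om -> Prop) :
  (forall i, {ae mu, forall w, P i w}) -> {ae mu, forall w, forall i, P i w}.
Proof.
(* Indices past the cardinal of [I] carry the trivial property, so countable stability of
   almost-everywhere statements applies. *)
move=> h; have : {ae mu, forall w, forall n, if insub n is Some r
    then P (enum_val (r : 'I_#|I|)) w else True}.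
  by apply: ae_foralln => n; case: insubP => [r _ _|_]; [exact: h|exact: aeW].
by apply: filterS => w Pw i; have := Pw (enum_rank i);
  rewrite valK enum_rankK.
Qed.

Lemma ae_eq_avg_sum (I : finType) (c : I -> R) (f : I -> Om -> R) :
  (forall i, mu.-integrable setT (EFin \o f i)) ->
  ae_eq mu setT (avg rho G (fun w => \sum_i c i * f i w))
    (fun w => \sum_i c i * avg rho G (f i) w).
Proof.
move=> fi.
have : {ae mu, forall w i, rho.-integrable setT (fun z => (f i (G (w, z)))%:E)}.
  by apply: ae_forall_fin => i; exact: ae_integrable_avg.
apply: filterS => w hw _; rewrite /avg.
exact: (@Rintegral_lincomb _ _ _ rho I (index_enum I) c).
Qed.

End averaging.

(** From every starting point [w], resampling by [G] and then by [G'] has the law of one resampling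
    by [G2]; Fubini merges the two averages. The equality is only almost everywhere because [f] is
    integrable along the noise only for almost every [w]. *)
Lemma avg_avg {d1 d2 d3 d4} {Om : measurableType d1} {Z : measurableType d2}
    {Z' : measurableType d3} {Z2 : measurableType d4} {R : realType}
    (mu : probability Om R) (rho : probability Z R) (rho' : probability Z' R)
    (rho2 : probability Z2 R)
    (G : Om * Z -> Om) (G' : Om * Z' -> Om) (G2 : Om * Z2 -> Om) (f : Om -> R) :
  measurable_fun setT G -> measurable_fun setT G' -> measurable_fun setT G2 ->
  (forall A, measurable A -> (mu \x rho2)%E (G2 @^-1` A) = mu A) ->
  (forall w A, measurable A ->
    (rho \x rho')%E ((fun p => G' (G (w, p.1), p.2)) @^-1` A) =
    rho2 ((fun z => G2 (w, z)) @^-1` A)) ->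
  mu.-integrable setT (EFin \o f) ->
  ae_eq mu setT (avg rho G (avg rho' G' f)) (avg rho2 G2 f).
Proof.
move=> mG mG' mG2 hG2 law fi; have mf := measurable_int _ fi.
have := ae_integrable_avg _ _ _ mG2 hG2 _ fi.
apply: filterS => w iw _; rewrite /avg.
have mGw : measurable_fun setT (fun p : Z * Z' => G' (G (w, p.1), p.2)).
  apply: (measurableT_comp mG'); apply: measurable_fun_pair => //.
  by apply: (measurableT_comp mG); exact: measurable_fun_pair.
have mG2w : measurable_fun setT (fun z => G2 (w, z)).
  by apply: measurableT_comp.
have iprod : (rho \x rho')%E.-integrable setT
    ((EFin \o f) \o (fun p => G' (G (w, p.1), p.2))).
  apply: (@law_integrable _ _ _ _ _ _ _ rho2 _ _ _ mG2w mGw) => //.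
  by move=> A mA; exact/esym/law.
rewrite /Rintegral -(@law_integral _ _ _ _ _ _ _ (rho \x rho')%E rho2 _ _
  mGw mG2w (law w) (EFin \o f))//.
have /= <- := integral12_prod_meas1 iprod; congr fine.
have := ae_integrable1 iprod => aei.
have mF : measurable_fun setT (fun x => \int[rho']_y (f (G' (G (w, x), y)))%:E)%E.
  by have := measurable_fubini_F iprod.
(* The real-valued inner average agrees with the extended-real inner integral wherever the latter is
   finite, which is almost everywhere. *)
apply: ae_eq_integral => //.
  by apply/measurable_EFinP; exact: measurableT_comp.
by apply: filterS aei => x ix _ /=; rewrite fineK//; exact: integrable_fin_num ix.
Qed.

(** * Probability measures determined by their values on boxes *)

Lemma box_setT (R : realType) (J : finType) :
  box (fun=> setT) = [set: vec J R].
Proof. by apply/seteqP; split. Qed.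

(** Boxes are stable under intersection, contain the whole space and generate the product
    sigma-algebra, so the uniqueness theorem for measures on a pi-system applies. *)
Lemma measure_box_unique (R : realType) (J : finType)
    (m1 m2 : probability (vec J R) R) :
  (forall A, (forall j, measurable (A j)) -> m1 (box A) = m2 (box A)) ->
  forall S, measurable S -> m1 S = m2 S.
Proof.
move=> m12 S mS.
pose G := [set B | exists2 A : J -> set R, (forall j, measurable (A j)) & B = box A].
apply: (@measure_unique _ R (vec J R) G (fun=> setT)) => //.
- apply/seteqP; split; last first.
    apply: smallest_sub; first exact: sigma_algebra_measurable.
    by move=> _ [A mA ->]; exact: measurable_box.
  apply: smallest_sub; first exact: smallest_sigma_algebra.
  move=> _ [j [B mB ->]]; apply: sub_sigma_algebra.
  exists (fun i => if i == j then B else setT); first by move=> i; case: ifP.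
  apply/seteqP; split=> [x Bx i|x /(_ j)]; rewrite ?eqxx//.
  by case: eqP => // ->.
- move=> _ _ [A mA ->] [B mB ->]; exists (fun j => A j `&` B j).
    by move=> j; exact: measurableI.
  by apply/seteqP; split=> [x [Ax Bx] j|x ABx]; [|by split=> j; have [] := ABx j].
- by move=> _; exists (fun=> setT) => //; rewrite box_setT.
- by rewrite bigcup_const//; exists 0%N.
- by move=> _ [A mA ->]; exact: m12.
- by move=> _; rewrite /= probability_setT ltry.
Qed.

Definition vec_pair {R : realType} {J1 J2 : finType} (p : vec J1 R * vec J2 R) :
  vec (J1 + J2)%type R :=
  fun j => match j with inl i => p.1 i | inr i => p.2 i end.

Lemma measurable_vec_pair (R : realType) (J1 J2 : finType) :
  measurable_fun setT (@vec_pair R J1 J2).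
Proof.
apply: measurable_to_vec => -[i|i] /=.
- by apply: measurableT_comp (measurable_vec_coord i) _; exact: measurable_fst.
- by apply: measurableT_comp (measurable_vec_coord i) _; exact: measurable_snd.
Qed.

(** A pair of vectors is encoded as one vector indexed by [J1 + J2], where a product of two boxes is
    again a box. *)
Lemma measure_box2_unique (R : realType) (J1 J2 : finType)
    (m1 m2 : probability (vec J1 R * vec J2 R)%type R) :
  (forall A B, (forall j, measurable (A j)) -> (forall j, measurable (B j)) ->
     m1 (box A `*` box B) = m2 (box A `*` box B)) ->
  forall S, measurable S -> m1 S = m2 S.
Proof.
move=> m12 S mS.
pose unpair (x : vec (J1 + J2)%type R) : vec J1 R * vec J2 R :=
  (fun i => x (inl i), fun i => x (inr i)).
have munpair : measurable_fun setT unpair.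
  apply: measurable_fun_pair; apply: measurable_to_vec => i;
  exact: measurable_vec_coord.
have unpairK p : unpair (vec_pair p) = p by case: p.
pose F : {mfun (vec J1 R * vec J2 R)%type >-> vec (J1 + J2)%type R} :=
  HB.pack (@vec_pair R J1 J2)
    (isMeasurableFun.Build _ _ _ _ _ (@measurable_vec_pair R J1 J2)).
have := @measure_box_unique R _ (distribution m1 F) (distribution m2 F).
rewrite /distribution/= /pushforward => /(_ _ (unpair @^-1` S)) h.
rewrite (_ : S = vec_pair @^-1` (unpair @^-1` S)); last first.
  by apply/seteqP; split => p; rewrite /= unpairK.
apply: h; last by rewrite -[X in measurable X]setTI; exact: munpair.
move=> A mA.
suff E : vec_pair @^-1` box A = box (A \o inl) `*` box (A \o inr).
  have := m12 (A \o inl) (A \o inr) (fun j => mA (inl j)) (fun j => mA (inr j)).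
  by rewrite -E.
apply/seteqP; split=> [[x y] /= Axy|[x y] [/= Ax Ay] [i|i]].
- by split => i; [exact: (Axy (inl i))|exact: (Axy (inr i))].
- exact: Ax.
- exact: Ay.
Qed.

(** * Laws of resampled points *)

Section glue_law.
Context {R : realType} {d : nat}.
Variable nu : 'I_d -> probability R R.
Local Notation X := (vec 'I_d R).
Implicit Types (u v : {set 'I_d}) (p q : 'I_d -> probability R R).

(** The marginals once the coordinates outside [u] have been resampled. *)
Definition mix u p (i : 'I_d) : probability R R := if i \in u then p i else nu i.

(** Independent coordinates with marginals [p] and [q], recorded on boxes only, so that Dirac masses
    and product measures are treated alike. *)
Definition boxlaw p q (m : probability (X * X)%type R) :=
  forall A B, (forall j, measurable (A j)) -> (forall j, measurable (B j)) ->
    m (box A `*` box B) = ((\prod_i p i (A i)) * (\prod_i q i (B i)))%E.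

Definition glue_pair u v (a : (X * X) * (vec (co u) R * vec (co v) R)) : X * X :=
  (Defs.glue a.1.1 a.2.1, Defs.glue a.1.2 a.2.2).

Definition nu_co2 u v : probability (vec (co u) R * vec (co v) R)%type R :=
  (nu_co nu u \x nu_co nu v)%E.

Lemma glue_in u (x : X) (z : vec (co u) R) i :
  i \in u -> Defs.glue x z i = x i.
Proof. by move=> iu; rewrite /Defs.glue insubF// iu. Qed.

Lemma measurable_glue_pair u v : measurable_fun setT (@glue_pair u v).
Proof.
apply: measurable_fun_pair; apply: measurable_to_vec => i; rewrite /Defs.glue;
  case: insubP => [j _ _|_].
- exact: (measurableT_comp (measurable_vec_coord j)
    (measurableT_comp measurable_fst measurable_snd)).
- exact: (measurableT_comp (measurable_vec_coord i)
    (measurableT_comp measurable_fst measurable_fst)).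
- exact: (measurableT_comp (measurable_vec_coord j)
    (measurableT_comp measurable_snd measurable_snd)).
- exact: (measurableT_comp (measurable_vec_coord i)
    (measurableT_comp measurable_snd measurable_fst)).
Qed.

Definition keep u (A : 'I_d -> set R) i := if i \in u then A i else setT.

Lemma glue_box u A x (z : vec (co u) R) :
  box A (Defs.glue x z) <-> box (keep u A) x /\ box (fun j => A (val j)) z.
Proof.
split=> [Axz|[Ax Az] i].
  split=> [i|j].
    rewrite /keep; case: ifPn => // iu.
    by have := Axz i; rewrite /Defs.glue insubF// iu.
  by have := Axz (val j); rewrite /Defs.glue valK.
rewrite /Defs.glue; case: insubP => [j _ <-|]; first exact: Az.
by rewrite negbK => iu; have := Ax i; rewrite /keep iu.
Qed.

Lemma nu_co_box u A : (forall j, measurable (A j)) ->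
  nu_co nu u (box (fun j : co u => A (val j))) =
  (\prod_i (if i \in u then 1 else nu i (A i)))%E.
Proof.
move=> mA; rewrite /nu_co prod_prob_box//.
rewrite (eq_bigr (fun i => if i \notin u then nu i (A i) else 1)%E); last first.
  by move=> i _; case: ifP.
rewrite -big_mkcond/=.
exact/esym/(big_sub [pred i | i \notin u]).
Qed.

Lemma prod_keep u (p : 'I_d -> probability R R) A :
  ((\prod_i p i (keep u A i)) * (\prod_i (if i \in u then 1 else nu i (A i))) =
  \prod_i mix u p i (A i))%E.
Proof.
rewrite -big_split/=; apply: eq_bigr => i _; rewrite /keep /mix.
by case: ifP => _; rewrite ?mule1// probability_setT mul1e.
Qed.

Lemma boxlaw_prod_prob p q :
  boxlaw p q (prod_prob p \x prod_prob q)%E.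
Proof.
move=> A B mA mB; rewrite [LHS]product_measure1E; [|exact: measurable_box..].
by congr (_ * _)%E; exact: prod_prob_box.
Qed.

Lemma measurable_keep u A : (forall j, measurable (A j)) ->
  forall j, measurable (keep u A j).
Proof. by move=> mA j; rewrite /keep; case: ifP. Qed.

Lemma boxlaw_glue_box u v p q (m : probability (X * X)%type R) : boxlaw p q m ->
  forall A B, (forall j, measurable (A j)) -> (forall j, measurable (B j)) ->
  (m \x nu_co2 u v)%E (@glue_pair u v @^-1` (box A `*` box B)) =
   ((\prod_i mix u p i (A i)) * (\prod_i mix v q i (B i)))%E.
Proof.
move=> mpq A B mA mB.
rewrite (_ : glue_pair u v @^-1` _ = (box (keep u A) `*` box (keep v B)) `*`
    (box (fun j : co u => A (val j)) `*` box (fun j : co v => B (val j)))); last first.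
  apply/seteqP; split => -[[x y] [z w]] /=.
    by move=> [/glue_box[? ?] /glue_box[? ?]].
  by move=> [[? ?] [? ?]]; split; apply/glue_box.
have mk := measurable_keep.
rewrite [LHS]product_measure1E; [|apply: measurableX; apply: measurable_box..];
  last 4 first.
- exact: mk.
- exact: mk.
- by move=> j; exact: mA.
- by move=> j; exact: mB.
rewrite -(prod_keep _ _ A) -(prod_keep _ _ B) muleACA.
congr (_ * _)%E; first by apply: mpq; exact: mk.
rewrite -!nu_co_box//; apply: product_measure1E; apply: measurable_box => j.
  exact: mA.
exact: mB.
Qed.

(** The preimage of a box under glueing is a product of boxes: kept coordinates retain their
    marginals and resampled ones receive [nu]. Since boxes determine the measure, the law of the
    result is known exactly. *)
Lemma boxlaw_glue u v p q (m : probability (X * X)%type R) : boxlaw p q m ->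
  forall S, measurable S -> (m \x nu_co2 u v)%E (@glue_pair u v @^-1` S) =
   (prod_prob (mix u p) \x prod_prob (mix v q))%E S.
Proof.
move=> mpq S mS.
pose F : {mfun ((X * X) * (vec (co u) R * vec (co v) R))%type >-> (X * X)%type} :=
  HB.pack (@glue_pair u v) (isMeasurableFun.Build _ _ _ _ _ (@measurable_glue_pair u v)).
apply: (@measure_box2_unique _ _ _ (distribution (m \x nu_co2 u v)%E F)
  (prod_prob (mix u p) \x prod_prob (mix v q))%E) => //.
move=> A B mA mB.
rewrite [RHS]boxlaw_prod_prob//.
exact: boxlaw_glue_box.
Qed.

Definition diracs (x : X) (i : 'I_d) : probability R R := \d_(x i).

Lemma prod_diracs (x : X) (A : 'I_d -> set R) :
  (\prod_i diracs x i (A i) = (x \in box A)%:R%:E)%E.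
Proof.
under eq_bigr do rewrite /diracs/= diracE.
rewrite prodEFin; congr EFin.
case: (boolP (x \in box A)); rewrite ?inE ?notin_setE => xA.
  by apply: big1 => i _; rewrite mem_set.
have [i Ai] : exists i, ~ A i (x i) by apply/existsNP.
by rewrite (bigD1 i)//= memNset// mul0r.
Qed.

Lemma boxlaw_dirac (x y : X) : boxlaw (diracs x) (diracs y) (\d_(x, y)).
Proof.
move=> A B mA mB.
rewrite /= diracE !prod_diracs -EFinM -natrM mulnb; congr (_%:R%:E).
by rewrite in_setX.
Qed.

(** The law of [w] after resampling, written as a product measure so that [boxlaw_glue] can be
    applied to it again. *)
Definition law (u v : {set 'I_d}) (w : X * X) : probability (X * X)%type R :=
  (prod_prob (mix u (diracs w.1)) \x prod_prob (mix v (diracs w.2)))%E.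

(** The case of [boxlaw_glue] where the starting point has a Dirac law; integrating against that
    Dirac mass selects the section at [w]. *)
Lemma glue_pair_law u v w S : measurable S ->
  nu_co2 u v ((fun z => glue_pair u v (w, z)) @^-1` S) = law u v w S.
Proof.
move=> mS; case: w => x y.
transitivity ((\d_(x, y) \x nu_co2 u v)%E (@glue_pair u v @^-1` S)); last first.
  exact: (@boxlaw_glue u v _ _ _ (boxlaw_dirac x y) S mS).
apply/esym; rewrite [LHS]/product_measure1 integral_dirac//; last first.
  apply: measurable_fun_xsection.
  by rewrite -[X in measurable X]setTI; exact: measurable_glue_pair.
rewrite diracT mul1e/=; congr (nu_co2 u v _).
by apply/seteqP; split=> z; rewrite /xsection/= inE.
Qed.

Lemma boxlaw_law u v w : boxlaw (mix u (diracs w.1)) (mix v (diracs w.2)) (law u v w).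
Proof. exact: boxlaw_prod_prob. Qed.

(** A coordinate survives two resamplings exactly when both keep it; this is the source of
    [E_w E_w' = E_(w \cap w')]. *)
Lemma mix_mix u u' p : mix u' (mix u p) = mix (u :&: u') p.
Proof.
by apply/funext => i; rewrite /mix inE; case: (i \in u'); rewrite ?andbT ?andbF.
Qed.

Lemma mix_nu u : mix u nu = nu.
Proof. by apply/funext => i; rewrite /mix; case: ifP. Qed.

Lemma glue_pair_invariant u v S : measurable S ->
  (nunu nu \x nu_co2 u v)%E (@glue_pair u v @^-1` S) = nunu nu S.
Proof.
move=> mS; rewrite (@boxlaw_glue u v nu nu)//; last exact: boxlaw_prod_prob.
by rewrite !mix_nu.
Qed.

Lemma measurable_glue_pairw u v w : measurable_fun setT (fun z => @glue_pair u v (w, z)).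
Proof.
by apply: (measurableT_comp (@measurable_glue_pair u v)); exact: measurable_fun_pair.
Qed.

(** The law after the first resampling is again a product, so [boxlaw_glue] describes the second
    one, and [mix_mix] identifies the outcome with a single resampling. *)
Lemma glue_pair_glue_pair_law u v u' v' w S : measurable S ->
  (nu_co2 u v \x nu_co2 u' v')%E
    ((fun a => glue_pair u' v' (glue_pair u v (w, a.1), a.2)) @^-1` S) =
  nu_co2 (u :&: u') (v :&: v') ((fun z => glue_pair _ _ (w, z)) @^-1` S).
Proof.
move=> mS.
transitivity ((law u v w \x nu_co2 u' v')%E (@glue_pair u' v' @^-1` S)); last first.
  rewrite glue_pair_law//.
  apply: (eq_trans (@boxlaw_glue u' v' _ _ _ (boxlaw_law u v w) _ mS)).
  by rewrite !mix_mix.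
have mE : measurable (@glue_pair u' v' @^-1` S).
  by rewrite -[X in measurable X]setTI; exact: measurable_glue_pair.
pose h x := nu_co2 u' v' (xsection (@glue_pair u' v' @^-1` S) x).
have mh : measurable_fun setT h by exact: measurable_fun_xsection.
(* Both product measures are integrals of the measure of a section; the outer variable is moved from
   the noise to the law of the resampled point. *)
rewrite [LHS]/product_measure1 [RHS]/product_measure1.
have := @law_ge0_integral _ _ _ _ _ _ _ (nu_co2 u v) (law u v w) _ id
  (measurable_glue_pairw u v w) (@measurable_id _ _ _) _ h mh
  (fun=> measure_ge0 _ _).
move=> <-; last by move=> A mA; rewrite preimage_id; exact: glue_pair_law.
apply: eq_integral => z _ /=; rewrite /h; congr (nu_co2 u' v' _).
Qed.

Lemma mix_setT p : mix [set: 'I_d]%SET p = p.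
Proof. by apply/funext => i; rewrite /mix inE. Qed.

(** Only side [i] of the box constrains the new coordinate; if another coordinate of [x] lies
    outside its side, both members vanish. *)
Lemma update_box (x : X) i A : (forall j, measurable (A j)) ->
  nu i ((update x i) @^-1` box A) =
  (\prod_j mix [set~ i]%SET (diracs x) j (A j))%E.
Proof.
move=> mA; rewrite -prod_keep prod_diracs.
rewrite (_ : \prod_j _ = nu i (A i))%E; last first.
  rewrite (bigD1 i)//= !inE eqxx/= big1 ?mule1// => j ji.
  by rewrite !inE ji.
have [xA|xA] := boolP (x \in box (keep [set~ i]%SET A)); rewrite ?mul1e ?mul0e.
  congr (nu i _); rewrite inE in xA; apply/seteqP; split=> t /=.
    by move=> /(_ i); rewrite /update eqxx.
  move=> At j; rewrite /update; case: eqP => [->//|/eqP ji].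
  by have := xA j; rewrite /keep !inE ji.
rewrite (_ : _ @^-1` _ = set0) ?measure0//; apply/seteqP; split=> t //= Axt.
move: xA; rewrite notin_setE; apply => j; rewrite /keep !inE; case: ifPn => // ji.
by have := Axt j; rewrite /update (negbTE ji).
Qed.

Lemma measurable_update (x : X) i : measurable_fun setT (update x i).
Proof.
apply: measurable_to_vec => j; rewrite /update; case: eqP => _.
  exact: measurable_id.
exact: measurable_cst.
Qed.

(** Redrawing one coordinate of [x] has the same law as keeping all the others and all of [y]. Hence
    [P_i] belongs to the family of averages [E_(u,v)]. *)
Lemma update1_law (x y : X) i S : measurable S ->
  nu i ((fun t => (update x i t, y)) @^-1` S) =
  nu_co2 [set~ i] [set: 'I_d]%SET ((fun z => glue_pair _ _ ((x, y), z)) @^-1` S).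
Proof.
move=> mS; rewrite glue_pair_law//.
have mF : measurable_fun setT (fun t => (update x i t, y)).
  by apply: measurable_fun_pair; [exact: measurable_update|exact: measurable_cst].
pose F : {mfun R >-> (X * X)%type} :=
  HB.pack (fun t => (update x i t, y)) (isMeasurableFun.Build _ _ _ _ _ mF).
apply: (@measure_box2_unique _ _ _ (distribution (nu i) F)) => // A B mA mB.
rewrite [RHS]boxlaw_law//= mix_setT prod_diracs -update_box// /distribution/pushforward/=.
have [yB|yB] := boolP (y \in box B); rewrite ?mule1 ?mule0.
  congr (nu i _); rewrite inE in yB; apply/seteqP; split=> t /=; first by case.
  by [].
rewrite (_ : _ @^-1` _ = set0) ?measure0//; apply/seteqP; split=> t //= -[_ yB'].
by move: yB; rewrite notin_setE.
Qed.

Lemma update2_law (x y : X) i S : measurable S ->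
  nu i ((fun t => (x, update y i t)) @^-1` S) =
  nu_co2 [set: 'I_d]%SET [set~ i] ((fun z => glue_pair _ _ ((x, y), z)) @^-1` S).
Proof.
move=> mS; rewrite glue_pair_law//.
have mF : measurable_fun setT (fun t => (x, update y i t)).
  by apply: measurable_fun_pair; [exact: measurable_cst|exact: measurable_update].
pose F : {mfun R >-> (X * X)%type} :=
  HB.pack (fun t => (x, update y i t)) (isMeasurableFun.Build _ _ _ _ _ mF).
apply: (@measure_box2_unique _ _ _ (distribution (nu i) F)) => // A B mA mB.
rewrite [RHS]boxlaw_law//= mix_setT prod_diracs -update_box// /distribution/pushforward/=.
have [xA|xA] := boolP (x \in box A); rewrite ?mul1e ?mul0e.
  congr (nu i _); rewrite inE in xA; apply/seteqP; split=> t /=; first by case.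
  by [].
rewrite (_ : _ @^-1` _ = set0) ?measure0//; apply/seteqP; split=> t //= -[xA' _].
by move: xA; rewrite notin_setE.
Qed.

End glue_law.

(** * Conditional expectations given part of the coordinates *)

Section cond_exp.
Context {R : realType} {d : nat}.
Variable nu : 'I_d -> probability R R.
Local Notation X := (vec 'I_d R).
Local Notation II := [set: 'I_d]%SET.
Local Notation mu := (nunu nu).
Implicit Types (u v : {set 'I_d}) (f g : X * X -> R).

(** The operator [E_(u,v)]: a version of the conditional expectation given [(x_u, y_v)] under [mu],
    with a value assigned at every point. *)
Definition cexp u v f : X * X -> R := avg (nu_co2 nu u v) (glue_pair u v) f.

Lemma measurable_cexp u v f : measurable_fun setT f ->
  measurable_fun setT (cexp u v f).
Proof. by apply: measurable_avg; exact: measurable_glue_pair. Qed.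

Lemma cexp_Lfun2 u v f : f \in Lfun mu 2%:E -> cexp u v f \in Lfun mu 2%:E.
Proof.
apply: avg_Lfun2; [exact: measurable_glue_pair|exact: glue_pair_invariant].
Qed.

Lemma ae_eq_cexp u v f g : measurable_fun setT f -> measurable_fun setT g ->
  ae_eq mu setT f g -> ae_eq mu setT (cexp u v f) (cexp u v g).
Proof.
by apply: ae_eq_avg; [exact: measurable_glue_pair|exact: glue_pair_invariant].
Qed.

Lemma Lfun2_integrable f : f \in Lfun mu 2%:E -> mu.-integrable setT (EFin \o f).
Proof.
move=> f2; apply/Lfun1_integrable; apply: Lfun_subset12 f2.
exact: fin_num_measure.
Qed.

Lemma Lfun2_measurable f : f \in Lfun mu 2%:E -> measurable_fun setT f.
Proof. by move=> /Lfun2P[]. Qed.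

Lemma cexp_lincomb (I : finType) u v (c : I -> R) (f : I -> X * X -> R) :
  (forall i, f i \in Lfun mu 2%:E) ->
  ae_eq mu setT (cexp u v (fun w => \sum_i c i * f i w))
    (fun w => \sum_i c i * cexp u v (f i) w).
Proof.
move=> f2; apply: ae_eq_avg_sum; [exact: measurable_glue_pair|exact: glue_pair_invariant|].
by move=> i; exact: Lfun2_integrable.
Qed.

Lemma cexp_cexp u v u' v' f : f \in Lfun mu 2%:E ->
  ae_eq mu setT (cexp u v (cexp u' v' f)) (cexp (u :&: u') (v :&: v') f).
Proof.
move=> f2; apply: avg_avg; [exact: measurable_glue_pair..|exact: glue_pair_invariant|
  |exact: Lfun2_integrable].
by move=> w A mA; exact: glue_pair_glue_pair_law.
Qed.

Lemma cexp_update1 i f (x y : X) : measurable_fun setT f ->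
  \int[nu i]_t f (update x i t, y) = cexp [set~ i] II f (x, y).
Proof.
move=> mf; rewrite /cexp /avg /Rintegral; congr fine.
have mF : measurable_fun setT (fun t => (update x i t, y)).
  by apply: measurable_fun_pair; [exact: measurable_update|exact: measurable_cst].
apply: (@law_integral _ _ _ _ _ _ _ (nu i) (nu_co2 nu [set~ i] II) _ _ mF
  (measurable_glue_pairw _ _ _) _ (EFin \o f)).
  by move=> A mA; exact: update1_law.
exact/measurable_EFinP.
Qed.

Lemma cexp_update2 i f (x y : X) : measurable_fun setT f ->
  \int[nu i]_t f (x, update y i t) = cexp II [set~ i] f (x, y).
Proof.
move=> mf; rewrite /cexp /avg /Rintegral; congr fine.
have mF : measurable_fun setT (fun t => (x, update y i t)).
  by apply: measurable_fun_pair; [exact: measurable_cst|exact: measurable_update].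
apply: (@law_integral _ _ _ _ _ _ _ (nu i) (nu_co2 nu II [set~ i]) _ _ mF
  (measurable_glue_pairw _ _ _) _ (EFin \o f)).
  by move=> A mA; exact: update2_law.
exact/measurable_EFinP.
Qed.

End cond_exp.

(** * Kernels on [D x D] extended by zero *)

Section on_box.
Context {R : realType} {d : nat}.
Variables (D : 'I_d -> set R) (nu : 'I_d -> probability R R).
Hypotheses (hD : forall i, measurable (D i)) (hnu : forall i, nu i (D i) = 1%E).
Local Notation X := (vec 'I_d R).
Local Notation II := [set: 'I_d]%SET.
Local Notation mu := (nunu nu).
Local Notation DD := (box D `*` box D).
Implicit Types (u v : {set 'I_d}) (f g : X * X -> R) (k : X -> X -> R).

(** As [D x D] has full measure, L^2 membership and almost-everywhere equality of kernels can be
    handled on the whole space through this extension. *)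
Definition ext0 k : X * X -> R := uncurry_kernel k \_ DD.

Lemma ext0E k x y : box D x -> box D y -> ext0 k (x, y) = k x y.
Proof. by move=> Dx Dy; rewrite /ext0 patchE mem_set. Qed.

Lemma measurable_DD : measurable DD.
Proof. by apply: measurableX; exact: measurable_box. Qed.

Lemma nunu_DD : mu DD = 1%E.
Proof.
rewrite [LHS]boxlaw_prod_prob//.
by rewrite (eq_bigr _ (fun i _ => hnu i)) big1_eq mule1.
Qed.

Lemma ae_DD : {ae mu, forall w, DD w}.
Proof.
exists (~` DD); split => //.
  by apply: measurableC; exact: measurable_DD.
by rewrite probability_setC ?nunu_DD ?subee//; exact: measurable_DD.
Qed.

Lemma ae_eq_kernelP k1 k2 :
  ae_eq_kernel D nu k1 k2 <-> ae_eq mu setT (ext0 k1) (ext0 k2).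
Proof.
split; apply: filterS => w h Dw; rewrite /ext0 !patchE in h *.
  by case: ifPn => //; rewrite inE; exact: h.
by have := h I; rewrite mem_set.
Qed.

Lemma ext0_ae k f : (forall x y, box D x -> box D y -> k x y = f (x, y)) ->
  ae_eq mu setT (ext0 k) f.
Proof.
move=> kf; apply: filterS ae_DD => -[x y] [/= Dx Dy] _.
by rewrite ext0E// kf.
Qed.

Lemma ext0_restrict k f : (forall x y, box D x -> box D y -> k x y = f (x, y)) ->
  ext0 k = f \_ DD.
Proof.
move=> kf; apply/funext => -[x y]; rewrite /ext0 !patchE; case: ifPn => //.
by rewrite inE => -[/= Dx Dy]; exact: kf.
Qed.

Lemma measurable_ext0 k f : (forall x y, box D x -> box D y -> k x y = f (x, y)) ->
  measurable_fun setT f -> measurable_fun setT (ext0 k).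
Proof.
move=> /ext0_restrict -> mf; apply/(measurable_restrictT _ measurable_DD).
exact: measurable_funTS.
Qed.

Lemma ext0_Lfun2 k f : (forall x y, box D x -> box D y -> k x y = f (x, y)) ->
  f \in Lfun mu 2%:E -> ext0 k \in Lfun mu 2%:E.
Proof.
move=> kf /Lfun2P[mf foo]; apply/Lfun2P; split.
  exact: measurable_ext0 kf mf.
apply: le_lt_trans foo; apply: ge0_le_integral => //.
- by move=> w _; rewrite lee_fin sqr_ge0.
- by apply/measurable_EFinP; apply: measurable_funX; exact: measurable_ext0 mf.
- by apply/measurable_EFinP; exact: measurable_funX.
- move=> w _; rewrite (ext0_restrict _ _ kf) patchE lee_fin.
  by case: ifP => _ //; rewrite expr0n/= sqr_ge0.
Qed.

Lemma box_glue u (x : X) (z : vec (co u) R) : box D x ->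
  box D (Defs.glue x z) <-> box_co D z.
Proof.
move=> Dx; rewrite glue_box; split=> [[]//|Dz]; split=> // i.
by rewrite /keep; case: ifP.
Qed.

(** Valid at every point of [D x D], as (b) requires: when [x] is in [D], the glued point is in [D]
    exactly when the noise is in [box_co], so restricting the domain amounts to extending the
    integrand by zero. *)
Lemma integrate_outE u v k x y : box D x -> box D y ->
  integrate_out D nu u v k x y = cexp nu u v (ext0 k) (x, y).
Proof.
move=> Dx Dy; rewrite /integrate_out Rintegral_mkcond /cexp /avg.
apply: eq_Rintegral => -[z w] _; rewrite patchE /ext0 /glue_pair/= patchE.
congr (if _ then _ else _).
apply/idP/idP; rewrite !inE/= => -[/(box_glue _ _ _ Dx) Dz /(box_glue _ _ _ Dy) Dw];
  by split.
Qed.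

Lemma box_update (x : X) i t : box D x -> box D (update x i t) <-> D i t.
Proof.
move=> Dx; split=> [/(_ i)|Dt j]; rewrite /update ?eqxx//.
by case: eqP => [->|_].
Qed.

Lemma proj1E i k x y : measurable_fun setT (ext0 k) -> box D x -> box D y ->
  Defs.proj D nu i (fun x' => k x' y) x = cexp nu [set~ i] II (ext0 k) (x, y).
Proof.
move=> mk Dx Dy; rewrite /Defs.proj Rintegral_mkcond -cexp_update1//.
apply: eq_Rintegral => t _; rewrite /ext0 !patchE/=.
congr (if _ then _ else _).
apply/idP/idP => /[!inE]/=; first by move=> /(box_update _ _ _ Dx).
by case=> /(box_update _ _ _ Dx).
Qed.

Lemma proj2E i k x y : measurable_fun setT (ext0 k) -> box D x -> box D y ->
  Defs.proj D nu i (fun y' => k x y') y = cexp nu II [set~ i] (ext0 k) (x, y).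
Proof.
move=> mk Dx Dy; rewrite /Defs.proj Rintegral_mkcond -cexp_update2//.
apply: eq_Rintegral => t _; rewrite /ext0 !patchE/=.
congr (if _ then _ else _).
apply/idP/idP => /[!inE]/=; first by move=> /(box_update _ _ _ Dy).
by case=> _ /(box_update _ _ _ Dy).
Qed.

End on_box.

(** * Moebius inversion *)

Section moebius.
Context {R : realType} {I : finType}.
Implicit Types (i : I) (u v a : {set I}).

(** Symmetric difference with [{i}]: the sign-reversing involution behind the cancellations
    below. *)
Definition toggle i u : {set I} := if i \in u then u :\ i else i |: u.

Lemma toggleK i : involutive (toggle i).
Proof.
move=> u; rewrite /toggle; case: (boolP (i \in u)) => iu.
  by rewrite finset.setD11 finset.setD1K.
by rewrite finset.setU11 finset.setU1K.
Qed.

Lemma in_toggle i u j : (j \in toggle i u) = if j == i then i \notin u else j \in u.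
Proof.
rewrite /toggle; case: ifPn => iu; rewrite !inE; case: eqP => // ->.
Qed.

Lemma toggleI i u : toggle i u :&: [set~ i] = u :&: [set~ i].
Proof.
by apply/setP => j; rewrite !inE in_toggle; case: eqP; rewrite ?andbF.
Qed.

Lemma sign_toggle i u : (-1) ^+ #|toggle i u| = - (-1) ^+ #|u| :> R.
Proof.
rewrite /toggle; case: ifPn => iu.
  by rewrite (cardsD1 i u) iu exprS mulN1r opprK.
by rewrite cardsU1 iu exprS mulN1r.
Qed.

Lemma sum_toggle i (F : {set I} -> R) :
  (forall u, F (toggle i u) = - F u) -> \sum_u F u = 0.
Proof.
move=> FN; have : \sum_u F u = - \sum_u F u.
  rewrite {1}(reindex_inj (inv_inj (toggleK i))) -sumrN.
  by apply: eq_bigr.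
lra.
Qed.

(* [(-1) ^ (#|u| - #|a|)], written without truncated subtraction. *)
Definition mob u a : R := if a \subset u then (-1) ^+ #|u| * (-1) ^+ #|a| else 0.

(** The value of [h] ignores [i], and as [i] is in [u], toggling [i] preserves inclusion in [u]
    while changing the sign. This becomes the zero-mean condition. *)
Lemma mob_cancel i u (h : {set I} -> R) : i \in u ->
  \sum_a mob u a * h (a :&: [set~ i]) = 0.
Proof.
move=> iu; apply: (sum_toggle i) => a.
rewrite toggleI /mob sign_toggle (_ : (toggle i a \subset u) = (a \subset u)).
  by case: ifP => _; rewrite ?mul0r ?oppr0// mulrN mulNr.
apply/fintype.subsetP/fintype.subsetP => au j ja.
  have [->//|ji] := eqVneq j i; apply: au.
  by rewrite in_toggle (negbTE ji).
have [->//|ji] := eqVneq j i; apply: au.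
by move: ja; rewrite in_toggle (negbTE ji).
Qed.

Lemma mob_id u : mob u u = 1.
Proof. by rewrite /mob subxx -expr2 sqrr_sign. Qed.

(** Moebius inversion on the subset lattice: it isolates the component [u] from the partial sums
    over the components contained in [b]. *)
Lemma mob_sub u a : \sum_b mob u b * (a \subset b)%:R = (a == u)%:R.
Proof.
have [->|au] := eqVneq a u.
  rewrite (bigD1 u)//= mob_id subxx mulr1 big1 ?addr0// => b bu.
  rewrite /mob; case: ifPn => [bsu|]; last by rewrite mul0r.
  by rewrite (_ : u \subset b = false) ?mulr0//; apply: contraNF bu => ub;
    rewrite finset.eqEsubset bsu.
have [/fintype.subsetPn[i ia iu]|] := boolP (~~ (a \subset u)).
  apply: big1 => b _; rewrite /mob.
  case: ifPn => [/fintype.subsetP bu|]; last by rewrite mul0r.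
  rewrite (_ : a \subset b = false) ?mulr0//.
  by apply: contraNF iu => /fintype.subsetP ab; exact/bu/ab.
rewrite negbK => asu; have [i iu ia] : exists2 i, i \in u & i \notin a.
  by apply/fintype.subsetPn; apply: contra au => ua; rewrite finset.eqEsubset asu.
(* Since [i] is not in [a], the indicator of [a \subset b] does not see whether [i] is in [b], so
   terms cancel in pairs. *)
rewrite -[RHS](mob_cancel i u (fun b => (a \subset b)%:R) iu); apply: eq_bigr => b _.
by congr (_ * _%:R); rewrite finset.subsetI (_ : a \subset [set~ i]%SET) ?andbT//
  finset.subsetC finset.sub1set inE.
Qed.

(** The dual relation, summing over the upper index: when all terms of the explicit formula are
    added, only the average that integrates nothing out remains. *)
Lemma mob_sup a : \sum_u mob u a = (a == [set: I]%SET)%:R.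
Proof.
have [->|aI] := eqVneq a [set: I]%SET.
  rewrite (bigD1 [set: I]%SET)//= mob_id big1 ?addr0// => u uI.
  by rewrite /mob finset.subTset (negbTE uI).
have [i _ ia] : exists2 i, i \in [set: I]%SET & i \notin a.
  by apply/fintype.subsetPn; rewrite finset.subTset.
apply: (sum_toggle i) => u; rewrite /mob sign_toggle.
rewrite (_ : (a \subset toggle i u) = (a \subset u)).
  by case: ifP => _; rewrite ?oppr0// mulNr.
apply/fintype.subsetP/fintype.subsetP => au j ja; have := au j ja; rewrite in_toggle;
by case: eqP => // ji; rewrite -ji ja in ia.
Qed.

(** The eigenvalue of [T_u] on a component indexed by [a]: each [I - P_j] contributes [j \in a],
    each [P_j] contributes [j \notin a]. *)
Lemma prod_mem_eq u a :
  (\prod_(j in u) (j \in a)%:R) * (\prod_(j in ~: u) (j \notin a)%:R) = (a == u)%:R :> R.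
Proof.
have [->|au] := eqVneq a u.
  rewrite !big1 ?mulr1// => j; rewrite ?inE => ->//.
have [/fintype.subsetPn[i ia iu]|] := boolP (~~ (a \subset u)).
  by rewrite [X in _ * X](bigD1 i) ?inE//= ia mul0r mulr0.
rewrite negbK => asu; have [i iu ia] : exists2 i, i \in u & i \notin a.
  by apply/fintype.subsetPn; apply: contra au => ua; rewrite finset.eqEsubset asu.
by rewrite (bigD1 i)//= (negbTE ia) !mul0r.
Qed.

End moebius.

(** * Finite linear combinations up to null sets *)

Section ae_sum.
Context {d} {T : measurableType d} {R : realType}.
Variable mu : probability T R.

Lemma ae_eq_lincomb (I : finType) (c : I -> R) (f g : I -> T -> R) :
  (forall i, ae_eq mu setT (f i) (g i)) ->
  ae_eq mu setT (fun w => \sum_i c i * f i w) (fun w => \sum_i c i * g i w).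
Proof.
move=> fg; have : {ae mu, forall w i, f i w = g i w}.
  by apply: ae_forall_fin => i; apply: filterS (fg i) => w; exact.
by apply: filterS => w fgw _; apply: eq_bigr => i _; rewrite fgw.
Qed.

Lemma Lfun2_lincomb (I : finType) (c : I -> R) (f : I -> T -> R) :
  (forall i, f i \in Lfun mu 2%:E) ->
  (fun w => \sum_i c i * f i w) \in Lfun mu 2%:E.
Proof.
move=> f2; have p1 : (1 <= 2%:E :> \bar R)%E by rewrite lee_fin ler1n.
have [L0 LD] := Lfun_submod_closed mu p1.
elim: (index_enum I) => [|i s IH].
  by rewrite (_ : (fun _ => _) = 0)//; apply/funext => w; rewrite big_nil.
rewrite (_ : (fun _ => _) = c i *: f i + (fun w => \sum_(i <- s) c i * f i w)).
  exact: LD.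
by apply/funext => w; rewrite big_cons.
Qed.

End ae_sum.

(** * Uniqueness and existence of the decomposition *)

Section decomposition.
Context {R : realType} {d : nat}.
Variables (D : 'I_d -> set R) (nu : 'I_d -> probability R R).
Hypotheses (hD : forall i, measurable (D i)) (hnu : forall i, nu i (D i) = 1%E).
Local Notation X := (vec 'I_d R).
Local Notation II := [set: 'I_d]%SET.
Local Notation W := ({set 'I_d} * {set 'I_d})%type.
Local Notation mu := (nunu nu).
Local Notation DD := (box D `*` box D).
Implicit Types (u v a b : {set 'I_d}) (w : W) (f g : X * X -> R) (k : X -> X -> R).
Implicit Types (F : W -> X * X -> R) (K : {set 'I_d} -> {set 'I_d} -> X -> X -> R).

(** The explicit formula of (a) in terms of the operators [E_(a,b)], summed over all pairs; pairs
    not contained in [(u, v)] have coefficient zero. *)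
Definition kappa u v f (x : X * X) : R :=
  \sum_(w : W) (mob u w.1 * mob v w.2) * cexp nu w.1 w.2 f x.

Lemma kappa_Lfun2 u v f : f \in Lfun mu 2%:E -> kappa u v f \in Lfun mu 2%:E.
Proof. by move=> f2; apply: Lfun2_lincomb => w; exact: cexp_Lfun2. Qed.

Lemma kanova_termE u v k x y : box D x -> box D y ->
  kanova_term D nu k u v x y = kappa u v (ext0 D k) (x, y).
Proof.
move=> Dx Dy; rewrite /kanova_term /kappa -(pair_bigA _ (fun a b =>
  mob u a * mob v b * cexp nu a b (ext0 D k) (x, y)))/= big_mkcond/=.
apply: eq_bigr => a _; rewrite /mob; case: ifPn => [au|_]; last first.
  by rewrite big1// => b _; rewrite !mul0r.
rewrite big_mkcond/=; apply: eq_bigr => b _.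
case: ifPn => [bv|_]; last by rewrite mulr0 mul0r.
rewrite integrate_outE//; congr (_ * _).
(* The exponent uses truncated subtraction; it splits into one exponent per argument because [a] and
   [b] are no larger than [u] and [v]. *)
rewrite -subnDA [X in (X - _)%N]addnC.
have ha := subset_leq_card au; have hb := subset_leq_card bv.
have -> : (#|v| + #|u| - (#|a| + #|b|) = (#|u| - #|a|) + (#|v| - #|b|))%N by lia.
have sgn m n : (n <= m)%N -> (-1) ^+ (m - n) = (-1) ^+ m * (-1) ^+ n :> R.
  by move=> nm; rewrite -[in RHS](subnK nm) exprD -mulrA -expr2 sqrr_sign mulr1.
by rewrite exprD !sgn.
Qed.

(* Functional form of [kanova_decomposition]: a function of [(x_u, y_v)] is fixed
   by every [cexp] that keeps at least these coordinates. *)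
Definition hoeffding F :=
  [/\ forall w, F w \in Lfun mu 2%:E,
      forall w a b, w.1 \subset a -> w.2 \subset b ->
        ae_eq mu setT (cexp nu a b (F w)) (F w),
      forall w i, i \in w.1 -> ae_eq mu setT (cexp nu [set~ i] II (F w)) (cst 0) &
      forall w i, i \in w.2 -> ae_eq mu setT (cexp nu II [set~ i] (F w)) (cst 0)].

Lemma cexp0 u v : cexp nu u v (cst 0) = cst 0.
Proof. by apply/funext => x; rewrite /cexp /avg Rintegral_cst// mul0r. Qed.

(** If [E_(a,b)] integrates out some coordinate [i] on which [F w] depends, it factors through the
    operator integrating out [i] alone, which kills [F w]. Otherwise it fixes [F w]. *)
Lemma hoeffding_cexp F w a b : hoeffding F ->
  ae_eq mu setT (cexp nu a b (F w))
    (fun x => ((w.1 \subset a) && (w.2 \subset b))%:R * F w x).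
Proof.
move=> [F2 Fdep Fz1 Fz2].
(* Absorption: the hypotheses give [E_(a,b) E_(u,v) = E_(a,b)], so a function killed by [E_(u,v)] is
   killed by [E_(a,b)]. *)
have null u v :
    a :&: u = a -> b :&: v = b -> ae_eq mu setT (cexp nu u v (F w)) (cst 0) ->
    ae_eq mu setT (cexp nu a b (F w)) (cst 0).
  move=> au bv uv0; rewrite -{1}au -{1}bv.
  apply: ae_eq_trans (ae_eq_sym (cexp_cexp nu a b u v _ (F2 w))) _.
  rewrite -(cexp0 a b); apply: ae_eq_cexp => //.
  by apply: measurable_cexp; exact: Lfun2_measurable.
have [wa|/fintype.subsetPn[i iw ia]] := boolP (w.1 \subset a); last first.
  rewrite [X in ae_eq _ _ _ X](_ : _ = cst 0); last first.
    by apply/funext => x /=; rewrite ?andbF mul0r.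
  apply: (null [set~ i]%SET II) => //; last exact: Fz1.
    by apply/finset.setIidPl; rewrite finset.subsetC finset.sub1set inE.
  by rewrite finset.setIT.
have [wb|/fintype.subsetPn[i iw ib]] := boolP (w.2 \subset b); last first.
  rewrite [X in ae_eq _ _ _ X](_ : _ = cst 0); last first.
    by apply/funext => x /=; rewrite ?andbF mul0r.
  apply: (null II [set~ i]%SET) => //; last exact: Fz2.
    by rewrite finset.setIT.
  by apply/finset.setIidPl; rewrite finset.subsetC finset.sub1set inE.
rewrite [X in ae_eq _ _ _ X](_ : _ = F w); first exact: Fdep.
by apply/funext => x; rewrite mul1r.
Qed.

Lemma hoeffding_cexp_sum F (c : W -> R) a b : hoeffding F ->
  ae_eq mu setT (cexp nu a b (fun x => \sum_(w : W) c w * F w x))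
    (fun x => \sum_(w : W) (c w * ((w.1 \subset a) && (w.2 \subset b))%:R) * F w x).
Proof.
move=> hF; have [F2 _ _ _] := hF.
apply: ae_eq_trans (cexp_lincomb nu W a b c F F2) _.
pose G w x := ((w.1 \subset a) && (w.2 \subset b))%:R * F w x.
rewrite [X in ae_eq _ _ _ X](_ : _ = fun x => \sum_(w : W) c w * G w x); last first.
  by apply/funext => x; apply: eq_bigr => w _; rewrite mulrA.
by apply: (ae_eq_lincomb mu _ c _ G) => w; exact: hoeffding_cexp.
Qed.

(** Applying [E_s] to the sum keeps the components contained in [s]; the Moebius weights in [kappa]
    then isolate [F (u, v)]. *)
Lemma hoeffding_unique F f u v : hoeffding F -> f \in Lfun mu 2%:E ->
  ae_eq mu setT f (fun x => \sum_(w : W) F w x) ->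
  ae_eq mu setT (kappa u v f) (F (u, v)).
Proof.
move=> hF f2 fF; have [F2 _ _ _] := hF.
have S2 : (fun x => \sum_(w : W) 1 * F w x) \in Lfun mu 2%:E by exact: Lfun2_lincomb.
have key (s : W) : ae_eq mu setT (cexp nu s.1 s.2 f)
    (fun x => \sum_(w : W) (1 * ((w.1 \subset s.1) && (w.2 \subset s.2))%:R) * F w x).
  apply: ae_eq_trans (hoeffding_cexp_sum F (fun=> 1) s.1 s.2 hF).
  apply: ae_eq_cexp; [exact: (Lfun2_measurable nu _ f2)|exact: (Lfun2_measurable nu _ S2)|].
  rewrite [X in ae_eq _ _ _ X](_ : _ = fun x => \sum_(w : W) F w x)//.
  by apply/funext => x; apply: eq_bigr => w _; rewrite mul1r.
apply: ae_eq_trans (ae_eq_lincomb mu _ _ _ _ key) _.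
apply: aeW => x _.
under eq_bigr do rewrite mulr_sumr.
(* The coefficient of each component is a product of two Moebius sums, one per argument, and
   vanishes away from [(u, v)]. *)
rewrite exchange_big/= (bigD1 (u, v))//= [X in _ + X]big1 ?addr0; last first.
  move=> -[a b] /= ab.
  rewrite (eq_bigr (fun s : W => (mob u s.1 * (a \subset s.1)%:R) *
     (mob v s.2 * (b \subset s.2)%:R) * F (a, b) x)); last first.
    by move=> s _; rewrite mul1r -mulnb natrM; ring.
  rewrite -mulr_suml -(pair_bigA _ (fun s t => (mob u s * (a \subset s)%:R) *
     (mob v t * (b \subset t)%:R)))/=.
  under eq_bigr do rewrite -mulr_sumr.
  rewrite -mulr_suml !mob_sub -natrM mulnb.
  by rewrite -xpair_eqE (negbTE ab) mul0r.
rewrite (eq_bigr (fun s : W => (mob u s.1 * (u \subset s.1)%:R) *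
     (mob v s.2 * (v \subset s.2)%:R) * F (u, v) x)); last first.
  by move=> s _; rewrite mul1r -mulnb natrM; ring.
rewrite -mulr_suml -(pair_bigA _ (fun s t => (mob u s * (u \subset s)%:R) *
   (mob v t * (v \subset t)%:R)))/=.
under eq_bigr do rewrite -mulr_sumr.
by rewrite -mulr_suml !mob_sub !eqxx !mul1r.
Qed.

Lemma ext0_measurable k : L2_kernel D nu k -> measurable_fun setT (ext0 D k).
Proof. exact: Lfun2_measurable. Qed.

Lemma ext0_proj1 i k : measurable_fun setT (ext0 D k) ->
  ae_eq mu setT (ext0 D (fun x y => Defs.proj D nu i (fun x' => k x' y) x))
    (cexp nu [set~ i] II (ext0 D k)).
Proof. by move=> mk; apply: ext0_ae => // x y Dx Dy; exact: proj1E. Qed.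

Lemma ext0_proj2 i k : measurable_fun setT (ext0 D k) ->
  ae_eq mu setT (ext0 D (fun x y => Defs.proj D nu i (fun y' => k x y') y))
    (cexp nu II [set~ i] (ext0 D k)).
Proof. by move=> mk; apply: ext0_ae => // x y Dx Dy; exact: proj2E. Qed.

Lemma decomposition_hoeffding k K : kanova_decomposition D nu k K ->
  hoeffding (fun w => ext0 D (K w.1 w.2)).
Proof.
move=> [K2 Kdep _ Kz1 Kz2]; split=> [w|[u v] a b/= ua vb|[u v] i /= iu|[u v] i /= iv].
- exact: K2.
- have [g [g2 gdep Kg]] := Kdep u v.
  have {}Kg := (ae_eq_kernelP D nu _ _).1 Kg.
  have mg := ext0_measurable _ g2; have mK := ext0_measurable _ (K2 u v).
  apply: ae_eq_trans (ae_eq_cexp nu a b _ _ mK mg Kg) _.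
  apply: ae_eq_trans (ae_eq_sym Kg).
  apply: ae_eq_sym; apply: ext0_ae => // x y Dx Dy.
  rewrite -integrate_outE// /integrate_out.
  (* Glued points agree with [x] on [u] and with [y] on [v], so on the domain the integrand is the
     constant [g x y]; the domain has mass one. *)
  transitivity (\int[(nu_co nu a \x nu_co nu b)%E]_(p in
      @box_co R d D a `*` @box_co R d D b)
      g x y).
    have mB u' : measurable (@box_co R d D u') by exact: measurable_box.
    rewrite Rintegral_cst; last by apply: measurableX; exact: mB.
    rewrite [X in fine X](_ : _ = 1%E) ?mulr1//.
    rewrite [LHS]product_measure1E//.
    rewrite [X in (X * _)%E](_ : _ = 1%E) ?[X in (_ * X)%E](_ : _ = 1%E) ?mule1//.
      by rewrite [LHS]nu_co_box// big1// => i _; case: ifP.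
    by rewrite [LHS]nu_co_box// big1// => i _; case: ifP.
  - exact: mB.
  - exact: mB.
  apply: eq_Rintegral => p; rewrite inE; case: p => z t [/= Dz Dt].
  apply: gdep => //; [exact/box_glue|exact/box_glue|..] => j ju;
    by rewrite glue_in//; apply: (fintype.subsetP _) ju.
- have mK := ext0_measurable _ (K2 u v).
  have E := ext0_proj1 i (K u v) mK.
  apply: ae_eq_trans (ae_eq_sym E) _.
  apply: ae_eq_trans ((ae_eq_kernelP D nu _ _).1 (Kz1 u v i iu)) _.
  exact: ext0_ae.
- have mK := ext0_measurable _ (K2 u v).
  have E := ext0_proj2 i (K u v) mK.
  apply: ae_eq_trans (ae_eq_sym E) _.
  apply: ae_eq_trans ((ae_eq_kernelP D nu _ _).1 (Kz2 u v i iv)) _.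
  exact: ext0_ae.
Qed.

Lemma kanova_term_depends u v k x y x' y' :
  (forall i, i \in u -> x i = x' i) -> (forall j, j \in v -> y j = y' j) ->
  kanova_term D nu k u v x y = kanova_term D nu k u v x' y'.
Proof.
have glue_eq a b (p q : X) (z : vec (co b) R) :
    b \subset a -> (forall i, i \in a -> p i = q i) ->
    Defs.glue p z = Defs.glue q z :> X.
  move=> /fintype.subsetP ba pq; apply/funext => i; rewrite /Defs.glue.
  by case: insubP => [//|/negPn ib]; exact: pq (ba _ ib).
move=> xx' yy'; apply: eq_bigr => a au; apply: eq_bigr => b bv.
congr (_ * _); rewrite /integrate_out; congr (Rintegral _ _ _).
by apply/funext => -[z w] /=; rewrite (glue_eq u a x x')// (glue_eq v b y y').
Qed.

(** After exchanging sums, [mob_sup] leaves only the pair [(II, II)], whose operator resamples no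
    coordinate and returns [k] itself. The identity is pointwise on [D x D]. *)
Lemma kanova_term_sum k x y : box D x -> box D y ->
  \sum_u \sum_v kanova_term D nu k u v x y = k x y.
Proof.
move=> Dx Dy.
rewrite (eq_bigr (fun u => \sum_v kappa u v (ext0 D k) (x, y))); last first.
  by move=> u _; apply: eq_bigr => v _; rewrite kanova_termE.
rewrite (pair_bigA _ (fun u v => kappa u v (ext0 D k) (x, y)))/= exchange_big/=.
rewrite (bigD1 (II, II))//= [X in _ + X]big1 ?addr0; last first.
  move=> [a b] /= ab; rewrite -mulr_suml.
  rewrite -(pair_bigA _ (fun u v => mob u a * mob v b))/=.
  under eq_bigr do rewrite -mulr_sumr.
  by rewrite -mulr_suml !mob_sup -natrM mulnb -xpair_eqE (negbTE ab) mul0r.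
rewrite -mulr_suml -(pair_bigA _ (fun u v => mob u II * mob v II))/=.
under eq_bigr do rewrite -mulr_sumr.
rewrite -mulr_suml !mob_sup !eqxx !mul1r -(ext0E D k x y Dx Dy).
rewrite /cexp /avg -[RHS]mulr1.
have glueT (p : X) (z : vec (co II) R) : Defs.glue p z = p.
  by apply/funext => i; rewrite glue_in.
rewrite (_ : (fun _ => _) = cst (ext0 D k (x, y))); last first.
  by apply/funext => z; rewrite /glue_pair /= !glueT.
rewrite Rintegral_cst//; congr (_ * _).
by rewrite [X in fine X](@probability_setT _ _ _ (nu_co2 nu II II)).
Qed.

Lemma ext0_kanova_term k u v :
  ae_eq mu setT (ext0 D (kanova_term D nu k u v)) (kappa u v (ext0 D k)).
Proof. by apply: ext0_ae => // x y Dx Dy; exact: kanova_termE. Qed.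

Lemma kanova_term_L2 k u v : L2_kernel D nu k ->
  L2_kernel D nu (kanova_term D nu k u v).
Proof.
move=> k2; apply: (ext0_Lfun2 D nu hD _ (kappa u v (ext0 D k))).
  by move=> x y Dx Dy; exact: kanova_termE.
exact: kappa_Lfun2.
Qed.

(** Composing with the operator that integrates out [x_i] replaces each [a] by [a] without [i], and
    the Moebius sum over [a] cancels. *)
Lemma kappa_zero1 f u v i : f \in Lfun mu 2%:E -> i \in u ->
  ae_eq mu setT (cexp nu [set~ i] II (kappa u v f)) (cst 0).
Proof.
move=> f2 iu.
apply: ae_eq_trans (cexp_lincomb nu W _ _ _ _ _) _ => [w|]; first exact: cexp_Lfun2.
apply: ae_eq_trans (ae_eq_lincomb mu W _ _ _ (fun w => cexp_cexp nu _ _ _ _ _ f2)) _.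
apply: aeW => x _.
rewrite -(pair_bigA _ (fun a b => mob u a * mob v b *
  cexp nu ([set~ i] :&: a) (II :&: b) f x))/= exchange_big/= big1// => b _.
transitivity (mob v b * \sum_a mob u a * cexp nu (a :&: [set~ i]) (II :&: b) f x).
  rewrite mulr_sumr; apply: eq_bigr => a _.
  by rewrite finset.setIC mulrA (mulrC (mob v b)).
by rewrite (mob_cancel i u (fun a => cexp nu a (II :&: b) f x) iu) mulr0.
Qed.

Lemma kappa_zero2 f u v i : f \in Lfun mu 2%:E -> i \in v ->
  ae_eq mu setT (cexp nu II [set~ i] (kappa u v f)) (cst 0).
Proof.
move=> f2 iv.
apply: ae_eq_trans (cexp_lincomb nu W _ _ _ _ _) _ => [w|]; first exact: cexp_Lfun2.
apply: ae_eq_trans (ae_eq_lincomb mu W _ _ _ (fun w => cexp_cexp nu _ _ _ _ _ f2)) _.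
apply: aeW => x _.
rewrite -(pair_bigA _ (fun a b => mob u a * mob v b *
  cexp nu (II :&: a) ([set~ i] :&: b) f x))/= big1// => a _.
transitivity (mob u a * \sum_b mob v b * cexp nu (II :&: a) (b :&: [set~ i]) f x).
  by rewrite mulr_sumr; apply: eq_bigr => b _; rewrite (finset.setIC b) mulrA.
by rewrite (mob_cancel i v (fun b => cexp nu (II :&: a) b f x) iv) mulr0.
Qed.

Lemma kanova_term_decomposition k : L2_kernel D nu k ->
  kanova_decomposition D nu k (kanova_term D nu k).
Proof.
move=> k2; split=> [u v|u v|||].
- exact: kanova_term_L2.
- exists (kanova_term D nu k u v); split; first exact: kanova_term_L2.
    by move=> x y x' y' _ _ _ _; exact: kanova_term_depends.
  exact: ae_eq_refl.
- by apply: aeW => -[x y] [/= Dx Dy]; rewrite /uncurry_kernel/= kanova_term_sum.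
- move=> u v i iu; apply/ae_eq_kernelP.
  have mK := ext0_measurable _ (kanova_term_L2 k u v k2).
  apply: ae_eq_trans (ext0_proj1 _ _ mK) _.
  apply: ae_eq_trans (ae_eq_cexp nu _ _ _ _ mK _ (ext0_kanova_term k u v)) _.
    by apply: (Lfun2_measurable nu); exact: kappa_Lfun2.
  apply: ae_eq_trans (kappa_zero1 _ _ _ _ k2 iu) _.
  by apply: ae_eq_sym; exact: ext0_ae.
- move=> u v i iv; apply/ae_eq_kernelP.
  have mK := ext0_measurable _ (kanova_term_L2 k u v k2).
  apply: ae_eq_trans (ext0_proj2 _ _ mK) _.
  apply: ae_eq_trans (ae_eq_cexp nu _ _ _ _ mK _ (ext0_kanova_term k u v)) _.
    by apply: (Lfun2_measurable nu); exact: kappa_Lfun2.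
  apply: ae_eq_trans (kappa_zero2 _ _ _ _ k2 iv) _.
  by apply: ae_eq_sym; exact: ext0_ae.
Qed.

End decomposition.

(** * Tensor products of projectors *)

Section tensor_projector.
Context {R : realType} {d : nat}.
Variables (D : 'I_d -> set R) (nu : 'I_d -> probability R R).
Hypotheses (hD : forall i, measurable (D i)) (hnu : forall i, nu i (D i) = 1%E).
Local Notation X := (vec 'I_d R).
Local Notation II := [set: 'I_d]%SET.
Local Notation W := ({set 'I_d} * {set 'I_d})%type.
Local Notation mu := (nunu nu).
Implicit Types (u v : {set 'I_d}) (w : W) (k : X -> X -> R) (c : W -> R).
Variables (F : W -> X * X -> R) (hF : hoeffding nu F).

(** Coefficients [c] of a kernel along the components [F]. Measurability is carried along because
    rewriting [P_i] as an average requires it. *)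
Definition spanned k c := measurable_fun setT (ext0 D k) /\
  ae_eq mu setT (ext0 D k) (fun x => \sum_(w : W) c w * F w x).

Let span_Lfun2 c : (fun x => \sum_(w : W) c w * F w x) \in Lfun mu 2%:E.
Proof. by have [F2 _ _ _] := hF; exact: Lfun2_lincomb. Qed.

Lemma eq_spanned k c c' : c =1 c' -> spanned k c -> spanned k c'.
Proof. by move=> /funext ->. Qed.

Definition lift1 (T : (X -> R) -> X -> R) k : X -> X -> R :=
  fun x y => T (fun x' => k x' y) x.

Definition lift2 (T : (X -> R) -> X -> R) k : X -> X -> R :=
  fun x y => T (fun y' => k x y') y.

(** The projector [P_i] on [x] is diagonal in the components: it fixes those not involving [x_i] and
    kills the others. *)
Lemma spanned_proj1 i k c : spanned k c ->
  spanned (lift1 (Defs.proj D nu i) k) (fun w => c w * (i \notin w.1)%:R).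
Proof.
move=> [mk kc]; split.
  apply: (measurable_ext0 D hD _ (cexp nu [set~ i] II (ext0 D k))).
    by move=> x y Dx Dy; exact: proj1E.
  exact: measurable_cexp.
apply: ae_eq_trans (ext0_proj1 D nu hD hnu i k mk) _.
apply: ae_eq_trans (ae_eq_cexp nu _ _ _ _ mk (Lfun2_measurable nu _ (span_Lfun2 c)) kc) _.
apply: ae_eq_trans (hoeffding_cexp_sum nu F c _ _ hF) _.
apply: aeW => x _; apply: eq_bigr => w _; congr (_ * _%:R * _).
by rewrite finset.subsetT andbT finset.subsetC finset.sub1set inE.
Qed.

Lemma spanned_proj2 i k c : spanned k c ->
  spanned (lift2 (Defs.proj D nu i) k) (fun w => c w * (i \notin w.2)%:R).
Proof.
move=> [mk kc]; split.
  apply: (measurable_ext0 D hD _ (cexp nu II [set~ i] (ext0 D k))).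
    by move=> x y Dx Dy; exact: proj2E.
  exact: measurable_cexp.
apply: ae_eq_trans (ext0_proj2 D nu hD hnu i k mk) _.
apply: ae_eq_trans (ae_eq_cexp nu _ _ _ _ mk (Lfun2_measurable nu _ (span_Lfun2 c)) kc) _.
apply: ae_eq_trans (hoeffding_cexp_sum nu F c _ _ hF) _.
apply: aeW => x _; apply: eq_bigr => w _; congr (_ * _%:R * _).
by rewrite finset.subsetT finset.subsetC finset.sub1set inE.
Qed.

Lemma spanned_sub k k' c c' : spanned k c -> spanned k' c' ->
  spanned (fun x y => k x y - k' x y) (fun w => c w - c' w).
Proof.
move=> [mk kc] [mk' kc'].
have -> : spanned (fun x y => k x y - k' x y) (fun w => c w - c' w) =
    (measurable_fun setT (fun p => ext0 D k p - ext0 D k' p) /\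
     ae_eq mu setT (fun p => ext0 D k p - ext0 D k' p)
       (fun x => \sum_(w : W) (c w - c' w) * F w x)).
  rewrite /spanned (_ : ext0 D _ = fun p => ext0 D k p - ext0 D k' p)//.
  apply/funext => p; rewrite /ext0 !patchE /uncurry_kernel; case: ifP => // _.
  by rewrite subr0.
split; first exact: measurable_funB.
apply: ae_eq_trans (ae_eq_sub kc kc') _.
apply: aeW => x _ /=; rewrite -sumrB; apply: eq_bigr => w _.
by rewrite mulrBl.
Qed.

Lemma spanned_subproj1 i k c : spanned k c ->
  spanned (lift1 (fun f x => f x - Defs.proj D nu i f x) k)
    (fun w => c w * (i \in w.1)%:R).
Proof.
move=> kc; apply: eq_spanned (spanned_sub _ _ _ _ kc (spanned_proj1 i _ _ kc)).
by move=> w; case: (i \in w.1); rewrite /= ?mulr1 ?mulr0 ?subr0 ?subrr.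
Qed.

Lemma spanned_subproj2 i k c : spanned k c ->
  spanned (lift2 (fun f x => f x - Defs.proj D nu i f x) k)
    (fun w => c w * (i \in w.2)%:R).
Proof.
move=> kc; apply: eq_spanned (spanned_sub _ _ _ _ kc (spanned_proj2 i _ _ kc)).
by move=> w; case: (i \in w.2); rewrite /= ?mulr1 ?mulr0 ?subr0 ?subrr.
Qed.

(** Here [L] stands for [lift1] or [lift2], both compatible with composition; composing diagonal
    operators multiplies their eigenvalues. *)
Lemma spanned_bigcomp (L : ((X -> R) -> X -> R) -> (X -> X -> R) -> X -> X -> R)
    (T : 'I_d -> (X -> R) -> X -> R) (t : 'I_d -> W -> R) :
  (forall k, L idfun k = k) ->
  (forall S S' k, L (S \o S') k = L S (L S' k)) ->
  (forall i k c, spanned k c -> spanned (L (T i) k) (fun w => c w * t i w)) ->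
  forall (u : {set 'I_d}) k c, spanned k c ->
    spanned (L (\big[comp/idfun]_(i in u) T i) k)
      (fun w => c w * \prod_(i in u) t i w).
Proof.
move=> L1 LM LT u k c kc; elim: (index_enum _) => [|i s IH].
  rewrite big_nil L1; apply: eq_spanned kc => w.
  by rewrite big_nil mulr1.
rewrite big_cons; case: ifPn => iu.
  rewrite LM; apply: eq_spanned (LT i _ _ IH) => w.
  by rewrite big_cons iu -mulrA [X in _ * X]mulrC.
apply: eq_spanned IH => w.
by rewrite big_cons (negbTE iu).
Qed.

Lemma spanned_Tproj1 u k c : spanned k c ->
  spanned (Tproj1 D nu u k) (fun w => c w * (w.1 == u)%:R).
Proof.
move=> kc.
have b1 := spanned_bigcomp lift1 _ _ (fun=> erefl) (fun _ _ _ => erefl)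
  spanned_proj1 (~: u) _ _ kc.
have b2 := spanned_bigcomp lift1 _ _ (fun=> erefl) (fun _ _ _ => erefl)
  spanned_subproj1 u _ _ b1.
apply: eq_spanned b2 => w.
by rewrite -mulrA [X in _ * X]mulrC prod_mem_eq.
Qed.

Lemma spanned_Tproj2 u k c : spanned k c ->
  spanned (Tproj2 D nu u k) (fun w => c w * (w.2 == u)%:R).
Proof.
move=> kc.
have b1 := spanned_bigcomp lift2 _ _ (fun=> erefl) (fun _ _ _ => erefl)
  spanned_proj2 (~: u) _ _ kc.
have b2 := spanned_bigcomp lift2 _ _ (fun=> erefl) (fun _ _ _ => erefl)
  spanned_subproj2 u _ _ b1.
apply: eq_spanned b2 => w.
by rewrite -mulrA [X in _ * X]mulrC prod_mem_eq.
Qed.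

Lemma spanned_delta k u v : spanned k (fun w => (w == (u, v))%:R) ->
  ae_eq mu setT (ext0 D k) (F (u, v)).
Proof.
move=> [_ kF]; apply: ae_eq_trans kF _; apply: aeW => x _.
rewrite (bigD1 (u, v))//= eqxx mul1r big1 ?addr0// => w wuv.
by rewrite (negbTE wuv) mul0r.
Qed.

End tensor_projector.

(** * Uniqueness and the tensor projector formula *)

Section part_a.
Context {R : realType} {d : nat}.
Variables (D : 'I_d -> set R) (nu : 'I_d -> probability R R).
Hypotheses (hD : forall i, measurable (D i)) (hnu : forall i, nu i (D i) = 1%E).
Local Notation X := (vec 'I_d R).
Implicit Types (u v : {set 'I_d}) (k : X -> X -> R)
  (K : {set 'I_d} -> {set 'I_d} -> X -> X -> R).

Lemma ext0_decomposition_sum k K : kanova_decomposition D nu k K ->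
  ae_eq (nunu nu) setT (ext0 D k)
    (fun x => \sum_(w : {set 'I_d} * {set 'I_d}) ext0 D (K w.1 w.2) x).
Proof.
move=> [_ _ /ae_eq_kernelP kK _ _]; apply: ae_eq_trans kK _.
apply: aeW => x _; rewrite -(pair_bigA _ (fun u v => ext0 D (K u v) x))/=.
rewrite /ext0 patchE; case: ifPn => xD.
  by apply: eq_bigr => u _; apply: eq_bigr => v _; rewrite patchE xD.
by rewrite big1// => u _; rewrite big1// => v _; rewrite patchE (negbTE xD).
Qed.

Lemma kanova_unique k K : L2_kernel D nu k -> kanova_decomposition D nu k K ->
  forall u v, ae_eq_kernel D nu (K u v) (kanova_term D nu k u v).
Proof.
move=> k2 kK u v; apply/ae_eq_kernelP.
apply: ae_eq_trans (ae_eq_sym (ext0_kanova_term D nu hD hnu k u v)).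
apply: ae_eq_sym.
apply: (hoeffding_unique nu (fun w => ext0 D (K w.1 w.2)) _ u v _ k2).
  exact: (decomposition_hoeffding D nu hD hnu k).
exact: ext0_decomposition_sum.
Qed.

Lemma kanova_term_spanned k : L2_kernel D nu k ->
  spanned D nu (fun w => ext0 D (kanova_term D nu k w.1 w.2)) k (fun=> 1).
Proof.
move=> k2; split; first exact: (ext0_measurable D nu).
have kK := kanova_term_decomposition D nu hD hnu k k2.
apply: ae_eq_trans (ext0_decomposition_sum _ _ kK) _.
by apply: aeW => x _; apply: eq_bigr => w _; rewrite mul1r.
Qed.

(** Along its own components [k] has all coefficients one; [T_v] on [y] and then [T_u] on [x]
    annihilate all of them but the one at [(u, v)]. *)
Lemma kanova_term_Tproj12 k u v : L2_kernel D nu k ->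
  ae_eq_kernel D nu (kanova_term D nu k u v) (Tproj1 D nu u (Tproj2 D nu v k)).
Proof.
move=> k2; apply/ae_eq_kernelP; apply: ae_eq_sym.
have hF := decomposition_hoeffding D nu hD hnu k _
  (kanova_term_decomposition D nu hD hnu k k2).
apply: (spanned_delta D nu (fun w => ext0 D (kanova_term D nu k w.1 w.2)) _ u v).
apply: eq_spanned (spanned_Tproj1 D nu hD hnu _ hF u _ _
  (spanned_Tproj2 D nu hD hnu _ hF v _ _ (kanova_term_spanned k k2))).
by move=> w; rewrite mul1r -natrM mulnb andbC -xpair_eqE -surjective_pairing.
Qed.

Lemma kanova_term_Tproj21 k u v : L2_kernel D nu k ->
  ae_eq_kernel D nu (kanova_term D nu k u v) (Tproj2 D nu v (Tproj1 D nu u k)).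
Proof.
move=> k2; apply/ae_eq_kernelP; apply: ae_eq_sym.
have hF := decomposition_hoeffding D nu hD hnu k _
  (kanova_term_decomposition D nu hD hnu k k2).
apply: (spanned_delta D nu (fun w => ext0 D (kanova_term D nu k w.1 w.2)) _ u v).
apply: eq_spanned (spanned_Tproj2 D nu hD hnu _ hF v _ _
  (spanned_Tproj1 D nu hD hnu _ hF u _ _ (kanova_term_spanned k k2))).
by move=> w; rewrite mul1r -natrM mulnb -xpair_eqE -surjective_pairing.
Qed.

End part_a.

(** * Positive definiteness of mixtures *)

Section bounded_integrals.
Context {R : realType}.

(** Boundedness makes the kernel integrable for every probability measure, so Fubini applies at
    every point and not just almost everywhere. *)
Definition bounded_mfun {d} {T : measurableType d} (f : T -> R) :=
  measurable_fun setT f /\ exists M, forall x, `|f x| <= M.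

Lemma bounded_integrable {d} {T : measurableType d} (m : probability T R) f :
  bounded_mfun f -> m.-integrable setT (EFin \o f).
Proof.
move=> [mf [M fM]].
apply: (@le_integrable _ _ _ m setT measurableT _ (EFin \o cst M)).
- exact/measurable_EFinP.
- move=> x _ /=; rewrite lee_fin; apply: le_trans (fM x) _.
  exact: ler_norm.
- exact: finite_measure_integrable_cst.
Qed.

Lemma bounded_Rintegral {d1 d2} {T1 : measurableType d1} {T2 : measurableType d2}
    (m : probability T2 R) (f : T1 * T2 -> R) :
  bounded_mfun f -> bounded_mfun (fun x => \int[m]_y f (x, y)).
Proof.
move=> bf; have [mf [M fM]] := bf; split.
  apply: (measurableT_comp (f := fine)); first by [].
  apply: (measurable_integral_pair m (fun p => (f p)%:E)).
  exact/measurable_EFinP.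
exists M => x.
have bs : bounded_mfun (fun y => f (x, y)).
  by split; [exact: measurableT_comp|exists M].
have b1 : bounded_mfun (fun y => `|f (x, y)|).
  split; last by exists M => y; rewrite normr_id.
  by apply: measurableT_comp; last exact: (proj1 bs).
apply: le_trans (le_normr_Rintegral measurableT (bounded_integrable _ _ bs)) _.
apply: (@le_trans _ _ (\int[m]_y M)).
  apply: le_Rintegral => //; first exact: bounded_integrable.
  exact: finite_measure_integrable_cst.
by rewrite Rintegral_cst// [X in fine X](@probability_setT _ _ _ m) mulr1.
Qed.

Lemma Rintegral_prod1 {d1 d2} {T1 : measurableType d1} {T2 : measurableType d2}
    (m1 : probability T1 R) (m2 : probability T2 R) (f : T1 * T2 -> R) :
  bounded_mfun f ->
  \int[(m1 \x m2)%E]_p f p = \int[m1]_x \int[m2]_y f (x, y).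
Proof.
move=> bf; have [mf [M fM]] := bf.
have fi := bounded_integrable (m1 \x m2)%E _ bf.
have /= e := integral12_prod_meas1 fi; rewrite /Rintegral -e; congr fine.
apply: eq_integral => x _; rewrite fineK//.
have bs : bounded_mfun (fun y => f (x, y)).
  by split; [exact: measurableT_comp|exists M].
exact: integrable_fin_num (bounded_integrable _ _ bs).
Qed.

Lemma Rintegral_prod2 {d1 d2} {T1 : measurableType d1} {T2 : measurableType d2}
    (m1 : probability T1 R) (m2 : probability T2 R) (f : T1 * T2 -> R) :
  bounded_mfun f ->
  \int[(m1 \x m2)%E]_p f p = \int[m2]_y \int[m1]_x f (x, y).
Proof.
move=> bf; have [mf [M fM]] := bf.
have fi := bounded_integrable (m1 \x m2)%E _ bf.
have /= e := integral21_prod_meas1 fi; rewrite /Rintegral -e; congr fine.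
apply: eq_integral => y _; rewrite fineK//.
have bs : bounded_mfun (fun x => f (x, y)).
  by split; [exact: measurableT_comp|exists M].
exact: integrable_fin_num (bounded_integrable _ _ bs).
Qed.

Lemma Rintegral_dirac {d} {T : measurableType d} (a : T) (f : T -> R) :
  measurable_fun setT f -> \int[\d_a]_x f x = f a.
Proof.
move=> mf; rewrite /Rintegral integral_dirac ?diracT ?mul1e//.
exact/measurable_EFinP.
Qed.

End bounded_integrals.

(** * Energies of families of probability measures *)

Section mixed_energy.
Context {d} {T : measurableType d} {R : realType}.
Variable K : T * T -> R.
Hypotheses (bK : bounded_mfun K) (spdK : spd_kernel setT (fun x y => K (x, y))).
Implicit Types m : probability T R.
Local Notation delta x := (\d_x : probability T R).

Definition energy m1 m2 : R := \int[(m1 \x m2)%E]_p K p.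

Lemma energyC m1 m2 : energy m1 m2 = energy m2 m1.
Proof.
rewrite /energy Rintegral_prod1// Rintegral_prod2//.
apply: eq_Rintegral => x _; apply: eq_Rintegral => y _.
by have [symK _] := spdK; exact: symK.
Qed.

Definition self_energy m : R := \int[m]_x K (x, x).

Lemma spd_fin (P : finType) (x : P -> T) (c : P -> R) :
  0 <= \sum_p \sum_q c p * c q * K (x p, x q).
Proof.
(* Positive definiteness is stated for at least one point; over an empty index type the sum is
   zero. *)
have [P0|P0] := posnP #|P|.
  rewrite big1// => p _; have := card0_eq P0 p; by rewrite !inE.
have reP (F : P -> R) : \sum_p F p = \sum_(i < #|P|) F (enum_val i).
  by rewrite (reindex (@enum_val P predT))//; apply: onW_bij; exact: enum_val_bij.
rewrite reP; under eq_bigr do rewrite reP.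
have [_ psdK] := spdK.
exact: (psdK #|P| (fun i => x (enum_val i)) (fun i => c (enum_val i)) P0 (fun=> Logic.I)).
Qed.

Lemma energy_diracl x m : energy (delta x) m = \int[m]_y K (x, y).
Proof.
rewrite /energy Rintegral_prod1// Rintegral_dirac//.
by have [] := bounded_Rintegral m K bK.
Qed.

Lemma energy_dirac x y : energy (delta x) (delta y) = K (x, y).
Proof.
rewrite energy_diracl Rintegral_dirac//.
by apply: measurableT_comp; [case: bK|].
Qed.

Let bdiag : bounded_mfun (fun x => K (x, x)).
Proof.
have [mK [M KM]] := bK; split; last by exists M.
by apply: (measurableT_comp mK); exact: measurable_fun_pair.
Qed.

Lemma self_energy_dirac x : self_energy (delta x) = K (x, x).
Proof. by rewrite /self_energy Rintegral_dirac//; case: bdiag. Qed.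

(* The expected energy of independent samples [X_p] of law [m p]: the terms
   [p = q] see a single point [K (X_p, X_p)]. *)
Definition sample_energy {P : eqType} (m : P -> probability T R) p q : R :=
  if p == q then self_energy (m p) else energy (m p) (m q).

(* [s] lists the measures that may fail to be Dirac masses; they are replaced by
   Dirac masses one at a time, conditioning on the sampled point. *)
Lemma sample_energy_ge0 (P : finType) (c : P -> R) (s : seq P)
    (m : P -> probability T R) :
  (forall p, p \notin s -> exists x, m p = delta x) ->
  0 <= \sum_p \sum_q c p * c q * sample_energy m p q.
Proof.
elim: s m => [|p0 s IH] m hm.
  have [x mx] : {x : P -> T & forall p, m p = delta (x p)}.
    have h p : {x | m p = delta x} by apply: cid; exact: hm.
    by exists (fun p => sval (h p)) => p; exact: svalP (h p).
  apply: le_trans (spd_fin P x c) _; rewrite le_eqVlt; apply/orP; left; apply/eqP.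
  apply: eq_bigr => p _; apply: eq_bigr => q _; congr (_ * _).
  rewrite /sample_energy !mx energy_dirac self_energy_dirac.
  by case: eqP => [->|].
pose mx x p : probability T R := if p == p0 then delta x else m p.
have h0 x : 0 <= \sum_p \sum_q c p * c q * sample_energy (mx x) p q.
  apply: IH => p ps; rewrite /mx; case: eqVneq => pp0; first by exists x.
  by apply: hm; rewrite inE negb_or pp0.
(* Averaging over [x] of law [m p0] restores each entry. On the diagonal this holds because
   [self_energy] is linear in the measure, whereas [energy] of a measure with itself is
   quadratic. *)
have step p q : bounded_mfun (fun x => sample_energy (mx x) p q) /\
    \int[m p0]_x sample_energy (mx x) p q = sample_energy m p q.
  have bcst (r : R) : bounded_mfun (fun _ : T => r) /\ \int[m p0]_x r = r.
    split; first by split; [exact: measurable_cst|exists `|r|].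
    by rewrite Rintegral_cst// [X in fine X](@probability_setT _ _ _ (m p0)) mulr1.
  rewrite /sample_energy /mx; have [->|pq] := eqVneq p q.
    have [->|qp0] := eqVneq q p0; last exact: bcst.
    by under eq_fun do rewrite self_energy_dirac.
  have [pp0|pp0] := eqVneq p p0.
    rewrite pp0 in pq *; rewrite (negbTE (_ : q != p0)); last by rewrite eq_sym.
    under eq_fun do rewrite energy_diracl.
    by split; [exact: bounded_Rintegral|rewrite /energy Rintegral_prod1].
  have [->|qp0] := eqVneq q p0; last exact: bcst.
  under eq_fun do rewrite energyC energy_diracl.
  by split; [exact: bounded_Rintegral|rewrite energyC /energy Rintegral_prod1].
suff <- : \int[m p0]_x (\sum_p \sum_q c p * c q * sample_energy (mx x) p q) =
    \sum_p \sum_q c p * c q * sample_energy m p q.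
  by apply: Rintegral_ge0 => x _.
under eq_Rintegral => x _ do
  rewrite (pair_bigA _ (fun p q => c p * c q * sample_energy (mx x) p q)).
rewrite Rintegral_lincomb; last first.
  by move=> pq; apply: bounded_integrable; exact: (step _ _).1.
rewrite (pair_bigA _ (fun p q => c p * c q * sample_energy m p q)).
by apply: eq_bigr => pq _; rewrite (step _ _).2.
Qed.

(** Replaces division by [N] and passage to the limit: if [a] were negative, an [n.+1] above
    [|b| / - a] would contradict the hypothesis. *)
Lemma ge0_of_scaled (a b : R) : (forall n : nat, 0 <= n.+1%:R * a + b) -> 0 <= a.
Proof.
move=> h; rewrite leNgt; apply/negP => a0.
have := h (Num.truncn (`|b| / - a)).
have : `|b| / - a < (Num.truncn (`|b| / - a)).+1%:R by exact: truncnS_gt.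
rewrite ltr_pdivrMr ?oppr_gt0// => h1 h2; have := ler_norm b; nra.
Qed.

Lemma energy_ge0 (P : finType) (c : P -> R) (m : P -> probability T R) :
  0 <= \sum_p \sum_q c p * c q * energy (m p) (m q).
Proof.
set A := (X in 0 <= X).
(* The diagonal correction, created by pairing a sample with itself; it grows like [N] while the
   main term grows like [N ^ 2]. *)
pose C := \sum_p c p * c p * (self_energy (m p) - energy (m p) (m p)).
apply: (ge0_of_scaled A C) => n; pose N := n.+1.
(* The second index counts [N] independent samples of each measure. *)
pose m' (ps : P * 'I_N) := m ps.1.
have : 0 <= \sum_ps \sum_qt c ps.1 * c qt.1 * sample_energy m' ps qt.
  apply: (sample_energy_ge0 _ (fun ps : P * 'I_N => c ps.1) (enum {: P * 'I_N})).
  by move=> p; rewrite mem_enum.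
rewrite (eq_bigr (fun ps : P * 'I_N =>
    N%:R * (\sum_q c ps.1 * c q * energy (m ps.1) (m q)) +
    c ps.1 * c ps.1 * (self_energy (m ps.1) - energy (m ps.1) (m ps.1)))); last first.
  move=> ps _; rewrite (eq_bigr (fun qt : P * 'I_N =>
      c ps.1 * c qt.1 * energy (m ps.1) (m qt.1) +
      if qt == ps then c ps.1 * c ps.1 * (self_energy (m ps.1) - energy (m ps.1) (m ps.1))
      else 0)); last first.
    move=> qt _; rewrite /sample_energy eq_sym; case: eqP => [->|_]; last by rewrite addr0.
    by rewrite /m'; ring.
  rewrite big_split/= -big_mkcond big_pred1_eq; congr (_ + _).
  rewrite -(pair_bigA _ (fun q (_ : 'I_N) => c ps.1 * c q * energy (m ps.1) (m q)))/=.
  rewrite mulr_sumr; apply: eq_bigr => q _.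
  by rewrite sumr_const card_ord mulr_natl.
rewrite big_split/= -(pair_bigA _ (fun p (_ : 'I_N) =>
  N%:R * \sum_q c p * c q * energy (m p) (m q)))/=.
rewrite -(pair_bigA _ (fun p (_ : 'I_N) =>
  c p * c p * (self_energy (m p) - energy (m p) (m p))))/=.
under eq_bigr do rewrite sumr_const card_ord -(mulr_natl (_ * _) N).
under [X in _ + X]eq_bigr do rewrite sumr_const card_ord -(mulr_natl (_ * _) N).
(* The whole sum equals [N * (N * A + C)], and the positive factor [N] is removed. *)
rewrite -!mulr_sumr -/A -/C -mulrDr pmulr_rge0// ltr0n//.
Qed.

End mixed_energy.

(** * The weighted kernel as an energy of resampled points *)

Section part_b.
Context {R : realType} {d : nat}.
Variables (D : 'I_d -> set R) (nu : 'I_d -> probability R R).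
Local Notation X := (vec 'I_d R).
Implicit Types (u v a b : {set 'I_d}) (f : X * X -> R) (k : X -> X -> R).

Definition coord_law u (x : X) : probability X R := prod_prob (mix nu u (diracs x)).

(** Given [(x, y)], the two arguments are resampled independently, so the average is the energy of
    their two laws, at every point. *)
Lemma cexp_energy u v f x y : measurable_fun setT f ->
  cexp nu u v f (x, y) = energy f (coord_law u x) (coord_law v y).
Proof.
move=> mf; rewrite /cexp /avg /energy /Rintegral; congr fine.
apply: (@law_integral _ _ _ _ _ _ _ (nu_co2 nu u v) (law nu u v (x, y)) _ id
  (measurable_glue_pairw _ _ _) (@measurable_id _ _ _) _ (EFin \o f)).
  by move=> A mA; rewrite preimage_id; exact: glue_pair_law.
exact/measurable_EFinP.
Qed.

Lemma spd_ext0 k : spd_kernel (box D) k -> spd_kernel setT (fun x y => ext0 D k (x, y)).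
Proof.
move=> [symk psdk]; split=> [x y _ _|n x a n0 _].
  rewrite /ext0 !patchE /uncurry_kernel/= !in_setX/= andbC.
  by case: ifP => // /andP[/set_mem Dy /set_mem Dx]; exact: symk.
have [[x0 Dx0]|noD] := pselect (exists x0, box D x0); last first.
  rewrite big1// => i _; rewrite big1// => j _.
  rewrite /ext0 patchE memNset ?mulr0// => -[/= Dx _].
  by apply: noD; exists (x i).
(* Points outside [D] are moved to [x0] and given weight zero, which leaves the quadratic form
   unchanged. *)
pose x' i := if x i \in box D then x i else x0.
pose a' i := if x i \in box D then a i else 0.
have Dx' i : box D (x' i) by rewrite /x'; case: ifP => // /set_mem.
apply: le_trans (psdk n x' a' n0 Dx') _; rewrite le_eqVlt; apply/orP; left; apply/eqP.
apply: eq_bigr => i _; apply: eq_bigr => j _.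
rewrite /ext0 patchE in_setX/= /a' /x'.
case: (x i \in box D); last by rewrite !mul0r mulr0.
by case: (x j \in box D); rewrite ?mulr0 ?mul0r.
Qed.

Lemma bounded_ext0 k : compact (box D) ->
  {within box D `*` box D, continuous (uncurry_kernel k)} ->
  exists M, forall p, `|ext0 D k p| <= M.
Proof.
move=> cD ck; have := continuous_compact ck (compact_setX cD cD).
(* The bound holds only for constants strictly above [M], hence [M + 1]; the maximum with [0] covers
   the points outside [D x D]. *)
move=> /compact_bounded[M [_ hM]]; exists (Num.max 0 (M + 1)) => p.
rewrite /ext0 patchE; case: ifPn => pD; last by rewrite normr0 le_max lexx.
rewrite le_max; apply/orP; right; apply: hM; first by rewrite ltrDl.
by exists p => //; exact/set_mem.
Qed.

Hypotheses (hD : forall i, measurable (D i)) (hnu : forall i, nu i (D i) = 1%E).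

(** Exchanging sums moves the weights from components to averages. The same [beta] appears on both
    arguments, which gives the quadratic-form shape needed for positivity. *)
Lemma kanova_term_weighted (alpha : {set 'I_d} -> R) k x y :
  measurable_fun setT (ext0 D k) -> box D x -> box D y ->
  let beta a := \sum_u alpha u * mob u a in
  \sum_u \sum_v alpha u * alpha v * kanova_term D nu k u v x y =
  \sum_a \sum_b beta a * beta b * energy (ext0 D k) (coord_law a x) (coord_law b y).
Proof.
move=> mk Dx Dy beta.
pose e a b := energy (ext0 D k) (coord_law a x) (coord_law b y).
transitivity (\sum_u \sum_v \sum_a \sum_b
    (alpha u * mob u a) * (alpha v * mob v b) * e a b).
  apply: eq_bigr => u _; apply: eq_bigr => v _; rewrite kanova_termE// /kappa.
  rewrite -(pair_bigA _ (fun a b => mob u a * mob v b * cexp nu a b (ext0 D k) (x, y)))/=.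
  rewrite mulr_sumr; apply: eq_bigr => a _; rewrite mulr_sumr; apply: eq_bigr => b _.
  by rewrite cexp_energy// -/(e a b); ring.
under eq_bigr do rewrite exchange_big/=.
rewrite exchange_big/=; apply: eq_bigr => a _.
under eq_bigr do rewrite exchange_big/=.
rewrite exchange_big/=; apply: eq_bigr => b _.
under eq_bigr do rewrite -mulr_suml -mulr_sumr.
by rewrite -!mulr_suml.
Qed.

Lemma kanova_weighted_spd (alpha : {set 'I_d} -> R) k : L2_kernel D nu k ->
  compact (box D) -> {within box D `*` box D, continuous (uncurry_kernel k)} ->
  spd_kernel (box D) k ->
  spd_kernel (box D) (fun x y => \sum_u \sum_v
    alpha u * alpha v * kanova_term D nu k u v x y).
Proof.
move=> k2 cD ck spdk.
have mk := ext0_measurable D nu k k2.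
have bk : bounded_mfun (ext0 D k) by split=> //; exact: bounded_ext0.
have spdK := spd_ext0 k spdk.
split=> [x y Dx Dy|n x c n0 Dx].
  rewrite !kanova_term_weighted// exchange_big/=; apply: eq_bigr => a _.
  by apply: eq_bigr => b _; rewrite energyC// [X in X * _]mulrC.
pose beta a := \sum_u alpha u * mob u a.
(* The family is indexed by pairs [(i, a)]: the point [x i] resampled outside [a], with weight
   [c i * beta a]. *)
have := energy_ge0 (ext0 D k) bk spdK ('I_n * {set 'I_d})%type
  (fun p => c p.1 * beta p.2) (fun p => coord_law p.2 (x p.1)).
rewrite -(pair_bigA _ (fun i a => \sum_q c i * beta a * (c q.1 * beta q.2) *
   energy (ext0 D k) (coord_law a (x i)) (coord_law q.2 (x q.1))))/=.
congr (0 <= _); apply: eq_bigr => i _.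
under eq_bigr do rewrite -(pair_bigA _ (fun j b => c i * beta _ * (c j * beta b) *
   energy (ext0 D k) (coord_law _ (x i)) (coord_law b (x j))))/=.
rewrite exchange_big/=; apply: eq_bigr => j _.
rewrite kanova_term_weighted// mulr_sumr; apply: eq_bigr => a _.
rewrite mulr_sumr; apply: eq_bigr => b _; rewrite /beta; ring.
Qed.

End part_b.

Theorem theorem1 (R : realType) (d : nat) (D : 'I_d -> set R)
    (nu : 'I_d -> probability R R) (k : vec 'I_d R -> vec 'I_d R -> R)
    (hd : (1 <= d)%N)
    (hD : forall i, measurable (D i))
    (hnu : forall i, nu i (D i) = 1%E)
    (hk : L2_kernel D nu k) :
  (* (a) *)
  (exists K : {set 'I_d} -> {set 'I_d} -> vec 'I_d R -> vec 'I_d R -> R,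
    [/\ kanova_decomposition D nu k K,
        (forall K' : {set 'I_d} -> {set 'I_d} -> vec 'I_d R -> vec 'I_d R -> R,
           kanova_decomposition D nu k K' ->
           forall u v : {set 'I_d}, ae_eq_kernel D nu (K' u v) (K u v)),
        (forall u v : {set 'I_d},
           ae_eq_kernel D nu (K u v) (kanova_term D nu k u v)),
        (forall u v : {set 'I_d},
           ae_eq_kernel D nu (K u v) (Tproj1 D nu u (Tproj2 D nu v k))) &
        (forall u v : {set 'I_d},
           ae_eq_kernel D nu (K u v) (Tproj2 D nu v (Tproj1 D nu u k)))]) /\
  (* (b) *)
  (compact (box D) ->
   {within box D `*` box D, continuous (uncurry_kernel k)} ->
   spd_kernel (box D) k ->
   forall alpha : {set 'I_d} -> R,
     spd_kernel (box D)
       (fun x y => \sum_(u : {set 'I_d}) \sum_(v : {set 'I_d})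
                     alpha u * alpha v * kanova_term D nu k u v x y)).
Proof.
split; last by move=> cD ck spdk alpha; exact: kanova_weighted_spd.
exists (kanova_term D nu k); split.
- exact: kanova_term_decomposition.
- by move=> K' hK' u v; exact: kanova_unique.
- by move=> u v; exact: ae_eq_refl.
- by move=> u v; exact: kanova_term_Tproj12.
- by move=> u v; exact: kanova_term_Tproj21.
Qed.
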